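(* Let $(A,B)$ satisfy (1.1)-(1.4) of the context and let $(A_+,A_-)$ be a pair of mappings describing an optimal synthesis. The canonical costs whose optimal synthesis is described by $(A_+,A_-)$ are the costs $c=(u+Kx)^\top R(u+Kx)$ such that: (1) the mapping $K$ is given by $K=(B^\top B)^{-1}B^\top(A-A_+)$; (2) the mapping $R$ is given by $R(t)=(\det Z(0))^{1/n}Z^{-1}(t)$, where $Z:\mathbb{R}\to\mathrm{Sym}(m)$ is a smooth mapping with positive definite values that is a solution of the linear equation $$(A_--A_+)\int_0^t\Phi_{A_+}(s,0)B(s)Z(s)B(s)^\top\Phi_{A_+}(s,0)^\top ds - B(t)Z(t)B(t)^\top\left(I-\Phi_{A_-}(t,0)^{-\top}\Phi_{A_+}(t,0)^\top\right)=0,$$ where $A_--A_+$ is evaluated at $t$.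
   Context: Notation: $M_{n,m}(\mathbb{R})$ denotes the real $n\times m$ matrices, $M_n(\mathbb{R})=M_{n,n}(\mathbb{R})$, $\mathrm{Sym}(n)$ the symmetric matrices in $M_n(\mathbb{R})$; $Q_1\succ Q_2$ means $Q_1-Q_2$ is positive definite; $X^{-\top}=(X^{-1})^\top$. $\Phi_A(t,\tau)$ is the transition matrix: $\partial_t\Phi_A(t,\tau)=A(t)\Phi_A(t,\tau)$, $\Phi_A(\tau,\tau)=I$. A mapping $A$ is exponentially stable if there are $\alpha,\beta>0$ with $\|\Phi_A(t,t_0)\|\le\alpha e^{-\beta(t-t_0)}$ for all $t\ge t_0$, and exponentially anti-stable if there are $\alpha,\beta>0$ with $\|\Phi_A(t,t_0)\|\le\alpha e^{\beta(t-t_0)}$ for all $t\le t_0$. Assumptions on $(A,B)$: (1.1) $A:\mathbb{R}\to M_n(\mathbb{R})$ and $B:\mathbb{R}\to M_{n,m}(\mathbb{R})$ are $C^\infty$ and bounded; (1.2) $B(t)$ is injective for every $t$; (1.3) for every $t$, $\mathrm{span}\{B_i(t)v: v\in\mathbb{R}^m, i\in\mathbb{N}\}=\mathbb{R}^n$, where $B_0=B$, $B_{i+1}=\dot B_i-AB_i$; (1.4) there are constants $s,\beta>0$ such that for every $t$, $\int_t^{t+s}\Phi_A(t,\tau)B(\tau)B(\tau)^\top\Phi_A(t,\tau)^\top d\tau\succ\beta I$. $\mathcal{C}_{LQ}$ is the set of quadratic costs $c(t,x,u)=x^\top Q(t)x+2x^\top S(t)u+u^\top R(t)u$ such that: $Q:\mathbb{R}\to\mathrm{Sym}(n)$,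 $S:\mathbb{R}\to M_{n,m}(\mathbb{R})$, $R:\mathbb{R}\to\mathrm{Sym}(m)$ are smooth and bounded; there is $\alpha>0$ with $R(t)\succ\alpha I$ for all $t$; and $Q(t)-S(t)R(t)^{-1}S(t)^\top$ is nonnegative (positive semidefinite) for all $t$. A canonical cost is a quadratic cost $(u+K(t)x)^\top R(t)(u+K(t)x)$ where $R:\mathbb{R}\to\mathrm{Sym}(m)$ is smooth, bounded, uniformly positive definite with $\det R(0)=1$, and $K:\mathbb{R}\to M_{m,n}(\mathbb{R})$ is smooth, bounded, with $A-BK$ exponentially stable; it belongs to $\mathcal{C}_{LQ}$ with $Q=K^\top RK$, $S=K^\top R$. The optimal synthesis of $c\in\mathcal{C}_{LQ}$ is the set of all trajectories, for all data $t_0<t_1$, $x_0,x_1\in\mathbb{R}^n$, minimizing $\int_{t_0}^{t_1}c(t,x_u(t),u(t))\,dt$ among trajectories $x_u$ of $\dot x=A(t)x+B(t)u$ with $x_u(t_0)=x_0$, $x_u(t_1)=x_1$. The optimal synthesis of the cost in $\mathcal{C}_{LQ}$ defined by $(Q,S,R)$ is described by the pair $(A_+,A_-)$, where $A_\pm=A-BR^{-1}(S^\top+B^\top P_\pm)$ and $P_+$ (resp. $P_-$) is the unique symmetric solution on $\mathbb{R}$ of $\dot P=-PA-A^\top P+(PB+S)R^{-1}(B^\top P+S^\top)-Q$ for which $A_+$ is exponentially stable (resp. $A_-$ is exponentially anti-stable).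
   Formalization: In the linear equation the integrand uses Φ_{A+}(t,s) in place of the printed Φ_{A+}(s,0), with which the claim is false for time-varying R; and det R(0)=1 is required explicitly in the characterization, since the exponent 1/n does not ensure it when m<n. *)

(* Defs.v *)
From HB Require Import structures.
From mathcomp Require Import all_boot all_order all_algebra.
From mathcomp Require Import all_classical all_reals all_analysis.
Set Implicit Arguments.
Unset Strict Implicit.
Unset Printing Implicit Defensive.
Import Order.TTheory GRing.Theory Num.Theory.
Import numFieldNormedType.Exports.
Local Open Scope classical_set_scope.
Local Open Scope ring_scope.

Section MatrixFunctions.
Variable R : realType.

Definition smooth (p q : nat) (F : R -> 'M[R]_(p, q)) : Prop :=
  forall (k : nat) (t : R), derivable (derive1n k F) t 1.

(* `|_| is the max norm on matrices; all norms are equivalent here, so that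
   boundedness and exponential (anti-)stability do not depend on this choice. *)
Definition bounded_mx (p q : nat) (F : R -> 'M[R]_(p, q)) : Prop :=
  exists M : R, forall t, `|F t| <= M.

Definition sym (p : nat) (M : 'M[R]_p) : Prop := M^T = M.

Definition qform (p : nat) (M : 'M[R]_p) (x : 'cV[R]_p) : R :=
  (x^T *m M *m x) 0 0.

(* Both are applied to symmetric matrices only. *)
Definition posdef (p : nat) (M : 'M[R]_p) : Prop :=
  forall x : 'cV[R]_p, x != 0 -> 0 < qform M x.

Definition possemidef (p : nat) (M : 'M[R]_p) : Prop :=
  forall x : 'cV[R]_p, 0 <= qform M x.

(* The oriented integral: int_a^b f = - int_b^a f when b < a. *)
Definition oint (a b : R) (f : R -> R) : R :=
  if a <= b then \int[lebesgue_measure]_(s in `[a, b]) f s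
  else - \int[lebesgue_measure]_(s in `[b, a]) f s.

Definition mxint (p q : nat) (a b : R) (F : R -> 'M[R]_(p, q)) : 'M[R]_(p, q) :=
  \matrix_(i, j) oint a b (fun s => F s i j).

Definition lin_span (V : lmodType R) (X : set V) : set V :=
  [set w | exists (N : nat) (a : 'I_N -> R) (v : 'I_N -> V),
     (forall i, X (v i)) /\ w = \sum_(i < N) a i *: v i].

End MatrixFunctions.

Section Systems.
Variables (R : realType) (n : nat).

(* For continuous A these equations determine Phi, the transition matrix. *)
Definition is_transition (A : R -> 'M[R]_n) (Phi : R -> R -> 'M[R]_n) : Prop :=
  forall tau,
    (forall t : R, is_derive t (1 : R) (fun r : R => Phi r tau) (A t *m Phi t tau)) /\
    Phi tau tau = 1%:M.

Definition exp_stable (A : R -> 'M[R]_n) : Prop :=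
  exists Phi, is_transition A Phi /\
    exists alpha beta : R, [/\ 0 < alpha, 0 < beta &
      forall t t0, t0 <= t -> `|Phi t t0| <= alpha * expR (- beta * (t - t0))].

Definition exp_antistable (A : R -> 'M[R]_n) : Prop :=
  exists Phi, is_transition A Phi /\
    exists alpha beta : R, [/\ 0 < alpha, 0 < beta &
      forall t t0, t <= t0 -> `|Phi t t0| <= alpha * expR (beta * (t - t0))].

Variable m : nat.

Fixpoint Bseq (A : R -> 'M[R]_n) (B : R -> 'M[R]_(n, m)) (i : nat) :
    R -> 'M[R]_(n, m) :=
  if i is j.+1 then fun t => derive1 (Bseq A B j) t - A t *m Bseq A B j t
  else B.

Definition injective_input (B : R -> 'M[R]_(n, m)) : Prop :=
  forall t, injective (fun v : 'cV[R]_m => B t *m v).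

Definition span_condition (A : R -> 'M[R]_n) (B : R -> 'M[R]_(n, m)) : Prop :=
  forall t, lin_span [set w : 'cV[R]_n | exists (v : 'cV[R]_m) (i : nat),
                        w = Bseq A B i t *m v] = setT.

Definition gramian_condition (PhiA : R -> R -> 'M[R]_n)
    (B : R -> 'M[R]_(n, m)) : Prop :=
  exists s beta : R, [/\ 0 < s, 0 < beta &
    forall t, posdef
      (mxint t (t + s) (fun tau =>
         PhiA t tau *m B tau *m (B tau)^T *m (PhiA t tau)^T) - beta%:M)].

End Systems.

Section Costs.
Variables (R : realType) (n m : nat).

Definition cost := R -> 'cV[R]_n -> 'cV[R]_m -> R.

Definition quadratic_cost (Q : R -> 'M[R]_n) (S : R -> 'M[R]_(n, m))
    (Rm : R -> 'M[R]_m) : cost :=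
  fun t x u =>
    qform (Q t) x + 2 * (x^T *m S t *m u) 0 0 + qform (Rm t) u.

Definition unif_posdef (Rm : R -> 'M[R]_m) : Prop :=
  exists alpha : R, 0 < alpha /\ forall t, posdef (Rm t - alpha%:M).

Definition C_LQ (Q : R -> 'M[R]_n) (S : R -> 'M[R]_(n, m))
    (Rm : R -> 'M[R]_m) : Prop :=
  [/\ [/\ (forall t, sym (Q t)), smooth Q & bounded_mx Q],
      smooth S /\ bounded_mx S,
      [/\ (forall t, sym (Rm t)), smooth Rm & bounded_mx Rm],
      unif_posdef Rm &
      forall t, possemidef (Q t - S t *m invmx (Rm t) *m (S t)^T)].

Variables (A : R -> 'M[R]_n) (B : R -> 'M[R]_(n, m)).

Definition riccati_solution (Q : R -> 'M[R]_n) (S : R -> 'M[R]_(n, m))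
    (Rm : R -> 'M[R]_m) (P : R -> 'M[R]_n) : Prop :=
  forall t : R, sym (P t) /\
    is_derive t (1 : R) P
      (- (P t *m A t) - (A t)^T *m P t
       + (P t *m B t + S t) *m invmx (Rm t) *m ((B t)^T *m P t + (S t)^T)
       - Q t).

Definition closed_loop (S : R -> 'M[R]_(n, m)) (Rm : R -> 'M[R]_m)
    (P : R -> 'M[R]_n) (t : R) : 'M[R]_n :=
  A t - B t *m invmx (Rm t) *m ((S t)^T + (B t)^T *m P t).

(* The solutions Pp and Pm (the P_+ and P_- of the Riccati equation) are unique
   under the standing assumptions on (A, B), so that c determines (Ap, Am). *)
Definition synthesis_described_by (c : cost) (Ap Am : R -> 'M[R]_n) : Prop :=
  exists (Q : R -> 'M[R]_n) (S : R -> 'M[R]_(n, m)) (Rm : R -> 'M[R]_m)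
         (Pp Pm : R -> 'M[R]_n),
    [/\ C_LQ Q S Rm /\ (forall t x u, c t x u = quadratic_cost Q S Rm t x u),
        riccati_solution Q S Rm Pp /\ exp_stable (closed_loop S Rm Pp),
        riccati_solution Q S Rm Pm /\ exp_antistable (closed_loop S Rm Pm) &
        forall t, Ap t = closed_loop S Rm Pp t /\ Am t = closed_loop S Rm Pm t].

Definition feedback_cost (K : R -> 'M[R]_(m, n)) (Rm : R -> 'M[R]_m) : cost :=
  fun t x u => qform (Rm t) (u + K t *m x).

Definition canonical_cost (c : cost) : Prop :=
  exists (K : R -> 'M[R]_(m, n)) (Rm : R -> 'M[R]_m),
    [/\ forall t x u, c t x u = feedback_cost K Rm t x u,
        [/\ (forall t, sym (Rm t)), smooth Rm & bounded_mx Rm],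
        unif_posdef Rm /\ \det (Rm 0) = 1,
        smooth K /\ bounded_mx K &
        exp_stable (fun t => A t - B t *m K t)].

End Costs.

(* Main.v *)
(* Put [D = P_- - P_+].  Steering a state to 0, or 0 to a state,
   on a window of length [s] costs a bounded amount by the Gramian condition, and
   this bounds every global symmetric solution of the Riccati equation; since
   [D' = - D A_1 - A_2^T D] for a difference of solutions with closed loops [A_1]
   and [A_2], the stabilizing solution is unique.  Hence a canonical cost has
   [P_+ = 0] and [A_+ = A - B K], which gives (1).  The kernel of [D] consists of
   initial values of common trajectories of [A_+] and [A_-], which vanish, so [D]
   is invertible and [V = - D^-1] satisfies
     [V' = A_- V + V A_+^T]  and  [(A_- - A_+) V = B R^-1 B^T],
   from which the equation for [Z = R^-1] follows by integration.

   Conversely put [T(t) = Phi_+(t,0)^-1 Phi_-(t,0)] and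
   [X(t) = int_0^t Phi_+(s,0)^-1 B Z B^T Phi_+(s,0)^-T ds].  For [t <> 0] the
   equation makes [C = (T - 1)^-1 X] symmetric and locally constant; its values [C_1]
   for [t > 0] and [C_2] for [t < 0] agree because [(T - 1) (C_1 - C_2)] vanishes at
   0 with all its derivatives, which the rank condition forbids otherwise.  Then
   [W = Phi_-(t,0) C Phi_+(t,0)^T] solves the equations of [V], so [- W^-1] is,
   up to scale, the antistable solution of the Riccati equation.  Finally, if the
   given synthesis comes from a cost with input weight [R_0], the equations of [V]
   and [W] yield [B Z R_0 = (W V^-1) B], where [W V^-1] is similar to a constant
   matrix: the eigenvalues of [Z R_0] and of its inverse are bounded, and so [R] is
   bounded and uniformly positive definite because [R_0] is. *)

Require Import Defs.
From mathcomp Require Import all_boot all_order all_algebra.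
From mathcomp Require Import all_classical all_reals all_analysis.
From mathcomp Require Import ring lra.
Set Implicit Arguments.
Unset Strict Implicit.
Unset Printing Implicit Defensive.
Import Order.TTheory GRing.Theory Num.Theory.
Import numFieldNormedType.Exports.
Local Open Scope classical_set_scope.
Local Open Scope ring_scope.

(** * Entrywise rules for sums and transposes *)

Lemma mxDE (R : nmodType) p q (M N : 'M[R]_(p, q)) i j :
  (M + N) i j = M i j + N i j.
Proof. by rewrite mxE. Qed.

(** Together with [mxDE], and unlike [mxE], it leaves products folded, so that [ring] treats entries
    of products as atoms. *)
Lemma mxNE (R : zmodType) p q (M : 'M[R]_(p, q)) i j : (- M) i j = - M i j.
Proof. by rewrite mxE. Qed.

Lemma trmxD (R : nmodType) p q (M N : 'M[R]_(p, q)) : (M + N)^T = M^T + N^T.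
Proof. by apply/matrixP => i j; rewrite !mxE. Qed.

Lemma trmxB (R : zmodType) p q (M N : 'M[R]_(p, q)) : (M - N)^T = M^T - N^T.
Proof. by apply/matrixP => i j; rewrite !mxE. Qed.

Lemma mx0E (R : nmodType) p q i j : (0 : 'M[R]_(p, q)) i j = 0.
Proof. by rewrite mxE. Qed.

Lemma trmxN (R : zmodType) p q (M : 'M[R]_(p, q)) : (- M)^T = - M^T.
Proof. by apply/matrixP => i j; rewrite !mxE. Qed.

(** * Calculus of matrix-valued functions *)

Section MatrixCalculus.
Variable R : realType.
Implicit Types (t : R).

Lemma is_derive_mxP p q (F : R -> 'M[R]_(p, q)) t (dF : 'M[R]_(p, q)) :
  is_derive t 1 F dF <->
  forall i j, is_derive t 1 (fun x => F x i j) (dF i j).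
Proof.
split=> [[dF1 dF2] i j|H].
- have d1 := (derivable_mxP F t 1).1 dF1 i j.
  by apply: DeriveDef => //; rewrite -dF2 derive_mx// mxE.
- have dF1 : derivable F t 1.
    by apply/derivable_mxP => i j; have [] := H i j.
  apply: DeriveDef => //; rewrite derive_mx//; apply/matrixP => i j.
  by rewrite mxE; have [] := H i j.
Qed.

Lemma is_derive_mulmx p q r (F : R -> 'M[R]_(p, q)) (G : R -> 'M[R]_(q, r)) t
    dF dG : is_derive t 1 F dF -> is_derive t 1 G dG ->
  is_derive t 1 (fun x => F x *m G x) (dF *m G t + F t *m dG).
Proof.
move=> /is_derive_mxP HF /is_derive_mxP HG; apply/is_derive_mxP => i j.
have -> : (fun x => (F x *m G x) i j) =
    \sum_(k < q) (fun x => F x i k * G x k j).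
  by apply/funext => x; rewrite mxE fct_sumE.
apply: is_derive_eq.
rewrite !mxE -big_split/=; apply: eq_bigr => k _.
by rewrite addrC; congr (_ + _); exact: mulrC.
Qed.

Lemma is_derive_trmx p q (F : R -> 'M[R]_(p, q)) t dF :
  is_derive t 1 F dF -> is_derive t 1 (fun x => (F x)^T) dF^T.
Proof.
move=> /is_derive_mxP HF; apply/is_derive_mxP => i j; rewrite mxE.
by under eq_fun do rewrite mxE; exact: HF.
Qed.

Lemma is_derive_mulmxl p q r (M : 'M[R]_(p, q)) (F : R -> 'M[R]_(q, r)) t dF :
  is_derive t 1 F dF -> is_derive t 1 (fun x => M *m F x) (M *m dF).
Proof.
move=> HF; have := is_derive_mulmx (is_derive_cst M t 1) HF.
by rewrite mul0mx add0r.
Qed.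

Lemma is_derive_mulmxr p q r (M : 'M[R]_(q, r)) (F : R -> 'M[R]_(p, q)) t dF :
  is_derive t 1 F dF -> is_derive t 1 (fun x => F x *m M) (dF *m M).
Proof.
move=> HF; have := is_derive_mulmx HF (is_derive_cst M t 1).
by rewrite mulmx0 addr0.
Qed.

Lemma derivable_sumr (I : Type) (r : seq I) (f : I -> R -> R) t :
  (forall i, derivable (f i) t 1) ->
  derivable (fun x => \sum_(i <- r) f i x) t 1.
Proof.
move=> H; elim: r => [|i r IH].
  rewrite (_ : (fun x => _) = cst 0); first exact: derivable_cst.
  by apply/funext => x; rewrite big_nil.
rewrite (_ : (fun x => _) = f i + (fun x => \sum_(j <- r) f j x)).
  by apply: derivableD; [exact: H|exact: IH].
by apply/funext => x; rewrite big_cons.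
Qed.

Lemma derivable_prodr (I : Type) (r : seq I) (f : I -> R -> R) t :
  (forall i, derivable (f i) t 1) ->
  derivable (fun x => \prod_(i <- r) f i x) t 1.
Proof.
move=> H; elim: r => [|i r IH].
  rewrite (_ : (fun x => _) = cst 1); first exact: derivable_cst.
  by apply/funext => x; rewrite big_nil.
rewrite (_ : (fun x => _) = f i * (fun x => \prod_(j <- r) f j x)).
  by apply: derivableM; [exact: H|exact: IH].
by apply/funext => x; rewrite big_cons.
Qed.

Lemma derivable_det p (F : R -> 'M[R]_p) t :
  derivable F t 1 -> derivable (fun x => \det (F x)) t 1.
Proof.
move=> /derivable_mxP HF; apply: derivable_sumr => s.
apply: derivableM; first exact: derivable_cst.
by apply: derivable_prodr => i; exact: HF.
Qed.

(** By Cramer's formula each entry of the inverse is a cofactor over the determinant, both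
    polynomial in the entries of [F]. *)
Lemma derivable_invmx p (F : R -> 'M[R]_p) t :
  (\forall x \near t, F x \in unitmx) -> derivable F t 1 ->
  derivable (fun x => invmx (F x)) t 1.
Proof.
move=> uF dF; apply/derivable_mxP => i j.
pose cof x := (-1) ^+ (j + i) * \det (row' j (col' i (F x))).
apply: (@near_eq_derivable _ _ _ (fun x => (\det (F x))^-1 * cof x)).
  by near=> x; rewrite /invmx (near uF x)// !mxE.
apply: derivableM.
  apply: derivableV; last exact: derivable_det.
  by have := nbhs_singleton uF; rewrite unitmxE unitfE.
apply: derivableM; first exact: derivable_cst.
apply: derivable_det; apply/derivable_mxP => k l.
by under eq_fun do rewrite !mxE; move/derivable_mxP : dF; exact.
Unshelve. all: by end_near. Qed.

(** Differentiate [F *m invmx F = 1], valid near [t], and solve. The local form serves for [T - 1],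
    which is singular at time 0. *)
Lemma is_derive_invmx_near p (F : R -> 'M[R]_p) t dF :
  (\forall x \near t, F x \in unitmx) -> is_derive t 1 F dF ->
  is_derive t 1 (fun x => invmx (F x)) (- (invmx (F t) *m dF *m invmx (F t))).
Proof.
move=> uF DF; have /derivableP DI := derivable_invmx uF (@ex_derive _ _ _ _ _ _ _ DF).
set G := 'D_1 _ t in DI; suff <- : G = - (invmx (F t) *m dF *m invmx (F t)) by [].
have [_] := is_derive_mulmx DF DI.
rewrite (@near_eq_derive _ _ _ _ (cst 1%:M)); last first.
  by near=> x; rewrite mulmxV//; exact: (near uF x).
rewrite derive_cst => /(congr1 (mulmx (invmx (F t)))).
rewrite mulmx0 mulmxDr mulKmx ?(nbhs_singleton uF)// mulmxA => /esym/eqP.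
by rewrite addrC addr_eq0 => /eqP.
Unshelve. all: by end_near. Qed.

Lemma is_derive_invmx p (F : R -> 'M[R]_p) t dF :
  (forall x, F x \in unitmx) -> is_derive t 1 F dF ->
  is_derive t 1 (fun x => invmx (F x)) (- (invmx (F t) *m dF *m invmx (F t))).
Proof. by move=> uF HF; apply: (is_derive_invmx_near _ HF); apply: filterE. Qed.

Lemma is_derive_continuous p q (F : R -> 'M[R]_(p, q)) t dF :
  is_derive t 1 F dF -> {for t, continuous F}.
Proof. by move=> [HF _]; exact/differentiable_continuous/derivable1_diffP. Qed.

Lemma is_derive_continuousr (F : R -> R) t dF :
  is_derive t 1 F dF -> {for t, continuous F}.
Proof. by move=> [HF _]; exact/differentiable_continuous/derivable1_diffP. Qed.

Lemma ler_of_derive (f df : R -> R) (a b : R) : a <= b ->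
  (forall x : R, a <= x <= b -> is_derive x 1 f (df x)) ->
  (forall x, a <= x <= b -> 0 <= df x) -> f a <= f b.
Proof.
move=> ab Hf Hdf.
have [||c] := @MVT_segment _ f df a b ab.
- by move=> x; rewrite in_itv/= => /andP[? ?]; apply: Hf; apply/andP; split; exact: ltW.
- apply: continuous_in_subspaceT => x /[!inE]/=; rewrite in_itv/= => xab.
  exact: is_derive_continuousr (Hf _ xab).
rewrite in_itv/= => cab E; rewrite -subr_ge0 E mulr_ge0 ?subr_ge0//.
exact: Hdf.
Qed.

Lemma eq_of_derive0r (f : R -> R) (a b : R) : a <= b ->
  (forall x : R, a <= x <= b -> is_derive x 1 f 0) -> f a = f b.
Proof.
move=> ab Hf; apply/eqP; rewrite eq_le; apply/andP; split.
  by apply: (ler_of_derive (df := fun=> 0)).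
rewrite -lerN2; apply: (@ler_of_derive (- f) (fun=> 0)) => // x xab.
by have := is_deriveN (Hf _ xab); rewrite oppr0.
Qed.

Lemma eq_of_derive0 p q (F : R -> 'M[R]_(p, q)) (a b : R) : a <= b ->
  (forall x : R, a <= x <= b -> is_derive x 1 F 0) -> F a = F b.
Proof.
move=> ab HF; apply/matrixP => i j.
apply: (@eq_of_derive0r (fun x => F x i j)) => // x /HF/is_derive_mxP.
by move=> /(_ i j); rewrite mxE.
Qed.

Lemma derive0_cst p q (F : R -> 'M[R]_(p, q)) (a b : R) :
  (forall x : R, is_derive x 1 F 0) -> F a = F b.
Proof.
move=> HF; have [ab|/ltW ba] := leP a b; first exact: eq_of_derive0.
by apply/esym; exact: eq_of_derive0.
Qed.

Lemma eq_of_derive p q (F G : R -> 'M[R]_(p, q)) (dF : R -> 'M[R]_(p, q)) a :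
  (forall x : R, is_derive x 1 F (dF x)) -> (forall x : R, is_derive x 1 G (dF x)) ->
  F a = G a -> forall t, F t = G t.
Proof.
move=> HF HG E t; apply/eqP; rewrite -subr_eq0; apply/eqP.
rewrite -[RHS](subrr (F a)) {2}E; apply: (@derive0_cst _ _ (F - G)) => x.
by have := is_deriveB (HF x) (HG x); rewrite subrr.
Qed.

End MatrixCalculus.

(** * Oriented integrals and primitives *)

Section Integral.
Variable R : realType.
Local Notation mu := (@lebesgue_measure R).

Lemma oint_FTC (f F : R -> R) (a b : R) :
  (forall x : R, is_derive x 1 F (f x)) -> continuous f ->
  oint a b f = F b - F a.
Proof.
move=> dF cf; suff H c d : c <= d -> \int[mu]_(s in `[c, d]) f s = F d - F c.
  rewrite /oint; case: ifPn => [/H//|]; rewrite -ltNge => /ltW/H ->.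
  by rewrite opprB.
rewrite le_eqVlt => /predU1P[->|cd].
  by rewrite set_itv1 Rintegral_set1 subrr.
rewrite /Rintegral (@continuous_FTC2 _ f F c d)//.
- exact: continuous_subspaceT.
- split.
  + by move=> x _; have [] := dF x.
  + apply: cvg_at_right_filter; exact: is_derive_continuousr (dF c).
  + apply: cvg_at_left_filter; exact: is_derive_continuousr (dF d).
- by move=> x _; rewrite derive1E; have [] := dF x.
Qed.

Lemma primitive_exists (f : R -> R) : continuous f ->
  exists F : R -> R, forall t : R, is_derive t 1 F (f t).
Proof.
move=> cf; exists (fun x => oint 0 x f) => t.
(* [c] lies to the left of both [0] and [t]: near [t] the oriented integral from [0] is the integral
   from [c] minus a constant, whatever the sign of [t]. *)
pose c := Num.min 0 t - 1; pose u := Num.max 0 t + 1.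
have c0 : c < 0 by rewrite /c; case: (lerP 0 t) => ?; lra.
have ct : c < t by rewrite /c; case: (lerP 0 t) => ?; lra.
have tu : t < u by rewrite /u; case: (lerP 0 t) => ?; lra.
have int_f v w : mu.-integrable `[v, w] (EFin \o f).
  apply: continuous_compact_integrable; first exact: segment_compact.
  exact: continuous_subspaceT.
have E x : c < x ->
    oint 0 x f = \int[mu]_(s in `[c, x]) f s - \int[mu]_(s in `[c, 0]) f s.
  move=> cx; have sp v w : c <= v -> v <= w -> \int[mu]_(s in `[c, w]) f s -
      \int[mu]_(s in `[c, v]) f s = \int[mu]_(s in `[v, w]) f s.
    move=> cv vw; rewrite Rintegral_itvB ?bnd_simp// Rintegral_itv_obnd_cbnd//.
    apply: (integrableS _ _ _ (int_f v w)) => //.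
    exact: subset_itv_oc_cc.
  rewrite /oint; case: ifPn => [x0|]; first by rewrite sp// ltW.
  by rewrite -ltNge => x0; rewrite -(sp x 0) ?opprB//; exact: ltW.
have [dF F'] := continuous_FTC1_closed tu (int_f c u) ct (cf t).
apply: (@near_eq_is_derive _ _ _
  (fun x => \int[mu]_(s in `[c, x]) f s - \int[mu]_(s in `[c, 0]) f s)).
  near=> x; rewrite -E//; near: x; exact: lt_nbhsr.
rewrite -[f t]subr0; apply: is_deriveB.
by apply: DeriveDef; [exact: dF|rewrite -derive1E; exact: F'].
Unshelve. all: by end_near. Qed.

Lemma mxint_FTC p q (f F : R -> 'M[R]_(p, q)) (a b : R) :
  (forall x : R, is_derive x 1 F (f x)) -> continuous f ->
  mxint a b f = F b - F a.
Proof.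
move=> dF cf; apply/matrixP => i j; rewrite !mxE.
apply: (@oint_FTC (fun s => f s i j) (fun s => F s i j)) => x.
  by have /is_derive_mxP := dF x; exact.
exact: (continuous_comp (cf x) (@coord_continuous _ _ _ i j _)).
Qed.

Lemma mx_primitive_exists p q (f : R -> 'M[R]_(p, q)) : continuous f ->
  exists F : R -> 'M[R]_(p, q), forall t : R, is_derive t 1 F (f t).
Proof.
move=> cf.
have H i j : exists F : R -> R, forall t : R, is_derive t 1 F (f t i j).
  apply: primitive_exists => x.
  exact: (continuous_comp (cf x) (@coord_continuous _ _ _ i j _)).
exists (fun t => \matrix_(i, j) sval (cid (H i j)) t) => t.
apply/is_derive_mxP => i j; under eq_fun do rewrite mxE.
exact: (svalP (cid (H i j))).
Qed.

End Integral.

(** * Closure properties of smooth functions *)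

Section Smooth.
Variable R : realType.

(* Differentiable [k.+1] times. *)
Fixpoint nsmooth (p q : nat) (k : nat) (F : R -> 'M[R]_(p, q)) : Prop :=
  (forall t : R, derivable F t 1) /\
  (if k is j.+1 then nsmooth j (derive1 F) else True).

(** The graded form [nsmooth] allows induction on the order of differentiability, through the
    product rule and through differential equations. *)
Lemma smoothP p q (F : R -> 'M[R]_(p, q)) :
  smooth F <-> forall k, nsmooth k F.
Proof.
split=> [sF k|].
  elim: k F sF => [|k IH] F sF; split=> //; try exact: (sF 0).
  by apply: IH => k' t; have := sF k'.+1 t; rewrite derive1Sn.
move=> H k; elim: k F H => [|k IH] F H t; first by have [] := H 0.
by rewrite derive1Sn; apply: IH => j; have [] := H j.+1.
Qed.

Lemma nsmoothS p q k (F : R -> 'M[R]_(p, q)) : nsmooth k.+1 F -> nsmooth k F.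
Proof.
elim: k F => [|k IH] F [dF sF]; split=> //.
exact: IH.
Qed.

Lemma nsmooth_is_derive p q k (F dF : R -> 'M[R]_(p, q)) :
  (forall t : R, is_derive t 1 F (dF t)) -> nsmooth k dF -> nsmooth k.+1 F.
Proof.
move=> H sF; split; first by move=> t; have [] := H t.
suff -> : derive1 F = dF by [].
by apply/funext => t; rewrite derive1E; have [] := H t.
Qed.

Lemma nsmooth0_is_derive p q (F dF : R -> 'M[R]_(p, q)) :
  (forall t : R, is_derive t 1 F (dF t)) -> nsmooth 0 F.
Proof. by move=> H; split=> // t; have [] := H t. Qed.

Lemma nsmooth_derive1 p q k (F : R -> 'M[R]_(p, q)) (t : R) :
  nsmooth k F -> is_derive t 1 F (derive1 F t).
Proof.
move=> H; rewrite derive1E; apply/derivableP.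
by case: k H => [|k] [].
Qed.

Lemma nsmooth_cst p q k (M : 'M[R]_(p, q)) : nsmooth k (fun=> M).
Proof.
elim: k M => [|k IH] M; first exact: (nsmooth0_is_derive (fun t => is_derive_cst M t _)).
exact: (nsmooth_is_derive (fun t => is_derive_cst M t _)).
Qed.

Lemma nsmoothD p q k (F G : R -> 'M[R]_(p, q)) :
  nsmooth k F -> nsmooth k G -> nsmooth k (fun t => F t + G t).
Proof.
elim: k F G => [|k IH] F G sF sG;
  have H t := is_deriveD (nsmooth_derive1 t sF) (nsmooth_derive1 t sG).
  exact: (nsmooth0_is_derive H).
by apply: (nsmooth_is_derive H); apply: IH; [case: sF|case: sG].
Qed.

Lemma nsmoothN p q k (F : R -> 'M[R]_(p, q)) :
  nsmooth k F -> nsmooth k (fun t => - F t).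
Proof.
elim: k F => [|k IH] F sF; have H t := is_deriveN (nsmooth_derive1 t sF).
  exact: (nsmooth0_is_derive H).
by apply: (nsmooth_is_derive H); apply: IH; case: sF.
Qed.

Lemma nsmooth_trmx p q k (F : R -> 'M[R]_(p, q)) :
  nsmooth k F -> nsmooth k (fun t => (F t)^T).
Proof.
elim: k F => [|k IH] F sF; have H t := is_derive_trmx (nsmooth_derive1 t sF).
  exact: (nsmooth0_is_derive H).
by apply: (nsmooth_is_derive H); apply: IH; case: sF.
Qed.

Lemma nsmooth_mulmx p q r k (F : R -> 'M[R]_(p, q)) (G : R -> 'M[R]_(q, r)) :
  nsmooth k F -> nsmooth k G -> nsmooth k (fun t => F t *m G t).
Proof.
elim: k F G => [|k IH] F G sF sG;
  have H t := is_derive_mulmx (nsmooth_derive1 t sF) (nsmooth_derive1 t sG).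
  exact: (nsmooth0_is_derive H).
apply: (nsmooth_is_derive H); apply: nsmoothD; apply: IH.
- by case: sF.
- exact: nsmoothS.
- exact: nsmoothS.
- by case: sG.
Qed.

(** The derivative of the inverse is a product of [F'] and two copies of the inverse, whose
    smoothness one order lower is the induction hypothesis. *)
Lemma nsmooth_invmx p k (F : R -> 'M[R]_p) : (forall t, F t \in unitmx) ->
  nsmooth k F -> nsmooth k (fun t => invmx (F t)).
Proof.
move=> uF; elim: k => [|k IH] sF;
  have H t := is_derive_invmx uF (nsmooth_derive1 t sF).
  exact: (nsmooth0_is_derive H).
apply: (nsmooth_is_derive H); apply: nsmoothN.
have sI := IH (nsmoothS sF).
by apply: nsmooth_mulmx => //; apply: nsmooth_mulmx => //; case: sF.
Qed.

Lemma smooth_cst p q (M : 'M[R]_(p, q)) : smooth (fun _ : R => M).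
Proof. by apply/smoothP => k; exact: nsmooth_cst. Qed.

Lemma smoothD p q (F G : R -> 'M[R]_(p, q)) :
  smooth F -> smooth G -> smooth (fun t => F t + G t).
Proof. by move=> /smoothP sF /smoothP sG; apply/smoothP => k; exact: nsmoothD. Qed.

Lemma smoothN p q (F : R -> 'M[R]_(p, q)) :
  smooth F -> smooth (fun t => - F t).
Proof. by move=> /smoothP sF; apply/smoothP => k; exact: nsmoothN. Qed.

Lemma smoothB p q (F G : R -> 'M[R]_(p, q)) :
  smooth F -> smooth G -> smooth (fun t => F t - G t).
Proof. by move=> sF sG; exact: (smoothD sF (smoothN sG)). Qed.

Lemma smooth_trmx p q (F : R -> 'M[R]_(p, q)) :
  smooth F -> smooth (fun t => (F t)^T).
Proof. by move=> /smoothP sF; apply/smoothP => k; exact: nsmooth_trmx. Qed.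

Lemma smooth_mulmx p q r (F : R -> 'M[R]_(p, q)) (G : R -> 'M[R]_(q, r)) :
  smooth F -> smooth G -> smooth (fun t => F t *m G t).
Proof.
by move=> /smoothP sF /smoothP sG; apply/smoothP => k; exact: nsmooth_mulmx.
Qed.

Lemma smooth_invmx p (F : R -> 'M[R]_p) : (forall t, F t \in unitmx) ->
  smooth F -> smooth (fun t => invmx (F t)).
Proof.
by move=> uF /smoothP sF; apply/smoothP => k; exact: nsmooth_invmx.
Qed.

Lemma smooth_scale p q (c : R) (F : R -> 'M[R]_(p, q)) :
  smooth F -> smooth (fun t => c *: F t).
Proof.
move=> sF; have := smooth_mulmx (@smooth_cst _ _ c%:M) sF.
by under eq_fun do rewrite mul_scalar_mx.
Qed.

Lemma smooth_is_derive p q (F : R -> 'M[R]_(p, q)) (t : R) :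
  smooth F -> is_derive t 1 F (derive1 F t).
Proof. by move=> /smoothP sF; exact: nsmooth_derive1 (sF 0). Qed.

Lemma smooth_derive1 p q (F : R -> 'M[R]_(p, q)) :
  smooth F -> smooth (derive1 F).
Proof. by move=> /smoothP sF; apply/smoothP => k; have [] := sF k.+1. Qed.

Lemma smooth_continuous p q (F : R -> 'M[R]_(p, q)) : smooth F -> continuous F.
Proof. by move=> sF t; exact: is_derive_continuous (smooth_is_derive t sF). Qed.

(* The right-hand side of an ordinary differential equation is as smooth as
   its solution, which is therefore smooth. *)
Lemma smooth_bootstrap p q (F dF : R -> 'M[R]_(p, q)) :
  (forall t : R, is_derive t 1 F (dF t)) ->
  (forall k, nsmooth k F -> nsmooth k dF) -> smooth F.
Proof.
move=> H b; apply/smoothP; elim=> [|k IH]; first exact: nsmooth0_is_derive H.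
by apply: (nsmooth_is_derive H); exact: b.
Qed.

Lemma smooth_primitive p q (F dF : R -> 'M[R]_(p, q)) :
  (forall t : R, is_derive t 1 F (dF t)) -> smooth dF -> smooth F.
Proof.
by move=> H /smoothP sdF; apply: (smooth_bootstrap H) => k _; exact: sdF.
Qed.

End Smooth.

(** * Uniform bounds in the max norm *)

Section BoundedFamilies.
Variable R : realType.

(** The index set is arbitrary because transition matrices and Gramians are bounded over pairs of
    times in a window. *)
Definition bounded_family (T : Type) (D : set T) p q (F : T -> 'M[R]_(p, q)) :=
  exists M : R, forall x, D x -> `|F x| <= M.

Lemma entry_le_norm p q (M : 'M[R]_(p, q)) i j : `|M i j| <= `|M|.
Proof.
rewrite [leRHS]/Num.Def.normr/= mx_normrE.
exact: (le_bigmax _ (fun ij : 'I_p * 'I_q => `|M ij.1 ij.2|) (i, j)).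
Qed.

Lemma norm_le_entry p q (M : 'M[R]_(p, q)) c : 0 <= c ->
  (forall i j, `|M i j| <= c) -> `|M| <= c.
Proof.
move=> c0 H; rewrite [leLHS]/Num.Def.normr/= mx_normrE.
by apply: bigmax_le => // -[i j] _; exact: H.
Qed.

(** The max norm is submultiplicative only up to the inner dimension; this is the origin of the
    factors [n%:R] in later constants. *)
Lemma norm_mulmx p q r (M : 'M[R]_(p, q)) (N : 'M[R]_(q, r)) :
  `|M *m N| <= q%:R * `|M| * `|N|.
Proof.
apply: norm_le_entry => [|i j]; first by rewrite !mulr_ge0.
rewrite mxE (le_trans (ler_norm_sum _ _ _))//.
apply: (@le_trans _ _ (\sum_(k < q) `|M| * `|N|)).
  by apply: ler_sum => k _; rewrite normrM ler_pM// entry_le_norm.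
by rewrite sumr_const card_ord -[leLHS]mulr_natl mulrA.
Qed.

Lemma norm_trmx p q (M : 'M[R]_(p, q)) : `|M^T| = `|M|.
Proof.
suff H p' q' (N : 'M[R]_(p', q')) : `|N^T| <= `|N|.
  by apply/eqP; rewrite eq_le H /= -{1}[M]trmxK H.
by apply: norm_le_entry => // i j; rewrite mxE entry_le_norm.
Qed.

Lemma bounded_familyM (T : Type) (D : set T) p q r (F : T -> 'M[R]_(p, q))
    (G : T -> 'M[R]_(q, r)) : bounded_family D F -> bounded_family D G ->
  bounded_family D (fun x => F x *m G x).
Proof.
move=> [a Ha] [b Hb]; exists (q%:R * `|a| * `|b|) => x Dx.
rewrite (le_trans (norm_mulmx _ _))// !ler_pM ?mulr_ge0//.
  exact: le_trans (Ha _ Dx) (ler_norm _).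
exact: le_trans (Hb _ Dx) (ler_norm _).
Qed.

Lemma bounded_familyD (T : Type) (D : set T) p q (F G : T -> 'M[R]_(p, q)) :
  bounded_family D F -> bounded_family D G ->
  bounded_family D (fun x => F x + G x).
Proof.
move=> [a Ha] [b Hb]; exists (a + b) => x Dx.
by rewrite (le_trans (ler_normD _ _))// lerD ?Ha ?Hb.
Qed.

Lemma bounded_familyT (T : Type) (D : set T) p q (F : T -> 'M[R]_(p, q)) :
  bounded_family D F -> bounded_family D (fun x => (F x)^T).
Proof. by move=> [a Ha]; exists a => x Dx; rewrite norm_trmx Ha. Qed.

Lemma bounded_family_comp (T : Type) (D : set T) p q (F : R -> 'M[R]_(p, q))
    (f : T -> R) : bounded_mx F -> bounded_family D (fun x => F (f x)).
Proof. by move=> [a Ha]; exists a => x _. Qed.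

Lemma bounded_mxE p q (F : R -> 'M[R]_(p, q)) :
  bounded_family setT F -> bounded_mx F.
Proof. by move=> [a Ha]; exists a => x; exact: Ha. Qed.

End BoundedFamilies.

Lemma bounded_mxM (R : realType) p q r (F : R -> 'M[R]_(p, q))
    (G : R -> 'M[R]_(q, r)) :
  bounded_mx F -> bounded_mx G -> bounded_mx (fun t => F t *m G t).
Proof.
by move=> bF bG; apply: bounded_mxE; apply: bounded_familyM;
  [case: bF => c H; exists c => ? _|case: bG => c H; exists c => ? _].
Qed.

Lemma bounded_mxD (R : realType) p q (F G : R -> 'M[R]_(p, q)) :
  bounded_mx F -> bounded_mx G -> bounded_mx (fun t => F t + G t).
Proof.
by move=> bF bG; apply: bounded_mxE; apply: bounded_familyD;
  [case: bF => c H; exists c => ? _|case: bG => c H; exists c => ? _].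
Qed.

Lemma bounded_mxB (R : realType) p q (F G : R -> 'M[R]_(p, q)) :
  bounded_mx F -> bounded_mx G -> bounded_mx (fun t => F t - G t).
Proof.
move=> bF [c Hc]; apply: bounded_mxD => //.
by exists c => t; rewrite normrN.
Qed.

Lemma bounded_mxT (R : realType) p q (F : R -> 'M[R]_(p, q)) :
  bounded_mx F -> bounded_mx (fun t => (F t)^T).
Proof. by move=> [c Hc]; exists c => t; rewrite norm_trmx. Qed.

(** * Quadratic forms *)

Section QuadraticForms.
Variable R : realType.

Definition dot p (x y : 'cV[R]_p) : R := (x^T *m y) 0 0.

Lemma dotE p (x y : 'cV[R]_p) : dot x y = \sum_i x i 0 * y i 0.
Proof. by rewrite /dot mxE; apply: eq_bigr => i _; rewrite mxE. Qed.

Lemma dotC p (x y : 'cV[R]_p) : dot x y = dot y x.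
Proof. by rewrite !dotE; apply: eq_bigr => i _; rewrite mulrC. Qed.

Lemma dot_mulmx p q (M : 'M[R]_(q, p)) (x : 'cV[R]_p) (y : 'cV[R]_q) :
  dot (M *m x) y = dot x (M^T *m y).
Proof. by rewrite /dot trmx_mul mulmxA. Qed.

Lemma dotDl p (x y z : 'cV[R]_p) : dot (x + y) z = dot x z + dot y z.
Proof. by rewrite /dot linearD mulmxDl mxE. Qed.

Lemma dotDr p (x y z : 'cV[R]_p) : dot z (x + y) = dot z x + dot z y.
Proof. by rewrite /dot mulmxDr mxE. Qed.

Lemma dotZl p c (x z : 'cV[R]_p) : dot (c *: x) z = c * dot x z.
Proof. by rewrite /dot linearZ -scalemxAl mxE. Qed.

Lemma dotZr p c (x z : 'cV[R]_p) : dot z (c *: x) = c * dot z x.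
Proof. by rewrite dotC dotZl dotC. Qed.

Lemma dotNl p (x z : 'cV[R]_p) : dot (- x) z = - dot x z.
Proof. by rewrite -scaleN1r dotZl mulN1r. Qed.

Lemma dotNr p (x z : 'cV[R]_p) : dot z (- x) = - dot z x.
Proof. by rewrite dotC dotNl dotC. Qed.

Lemma dot0l p (x : 'cV[R]_p) : dot 0 x = 0.
Proof. by rewrite -[0](scale0r 0) dotZl mul0r. Qed.

Lemma dot0r p (x : 'cV[R]_p) : dot x 0 = 0.
Proof. by rewrite dotC dot0l. Qed.

Lemma qformE p (M : 'M[R]_p) (x : 'cV[R]_p) : qform M x = dot x (M *m x).
Proof. by rewrite /qform /dot mulmxA. Qed.

Lemma qform_mulmx p q (M : 'M[R]_q) (F : 'M[R]_(q, p)) (x : 'cV[R]_p) :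
  qform (F^T *m M *m F) x = qform M (F *m x).
Proof. by rewrite !qformE dot_mulmx !mulmxA. Qed.

Lemma qformD p (M N : 'M[R]_p) x : qform (M + N) x = qform M x + qform N x.
Proof. by rewrite !qformE mulmxDl dotDr. Qed.

Lemma qformN p (M : 'M[R]_p) x : qform (- M) x = - qform M x.
Proof. by rewrite !qformE mulNmx dotNr. Qed.

Lemma qformZ p c (M : 'M[R]_p) x : qform (c *: M) x = c * qform M x.
Proof. by rewrite !qformE -scalemxAl dotZr. Qed.

Lemma qform_scalar p c (x : 'cV[R]_p) : qform c%:M x = c * dot x x.
Proof. by rewrite qformE mul_scalar_mx dotZr. Qed.

Lemma qform0 p (M : 'M[R]_p) : qform M 0 = 0.
Proof. by rewrite qformE dot0l. Qed.

Lemma qform_mx0 p x : qform (0 : 'M[R]_p) x = 0.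
Proof. by rewrite qformE mul0mx dot0r. Qed.

Lemma qform_add p (M : 'M[R]_p) x y : sym M ->
  qform M (x + y) = qform M x + 2 * dot x (M *m y) + qform M y.
Proof.
move=> sM; rewrite !qformE mulmxDr !dotDl !dotDr.
by rewrite (dotC y (M *m x)) dot_mulmx sM; ring.
Qed.

Lemma dot_ge0 p (x : 'cV[R]_p) : 0 <= dot x x.
Proof. by rewrite dotE sumr_ge0// => i _; rewrite -expr2 sqr_ge0. Qed.

Lemma dot_eq0 p (x : 'cV[R]_p) : dot x x = 0 -> x = 0.
Proof.
rewrite dotE => /psumr_eq0P H; apply/matrixP => i j; rewrite ord1 mxE.
have /eqP := H (fun i _ => sqr_ge0 (x i 0)) i isT.
by rewrite mulf_eq0 orbb => /eqP.
Qed.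

Lemma dot_gt0 p (x : 'cV[R]_p) : x != 0 -> 0 < dot x x.
Proof.
move=> x0; rewrite lt_neqAle dot_ge0 andbT eq_sym.
by apply: contra x0 => /eqP/dot_eq0 ->.
Qed.

Lemma entry_le_dot p (x : 'cV[R]_p) i : x i 0 ^+ 2 <= dot x x.
Proof.
rewrite dotE (bigD1 i)//= -expr2 lerDl sumr_ge0// => j _.
by rewrite -expr2 sqr_ge0.
Qed.

(** From [|a| <= 1 + a^2] on entries, which avoids square roots. *)
Lemma norm_le_dot p (x : 'cV[R]_p) (c : R) : dot x x <= c -> `|x| <= 1 + c.
Proof.
move=> H; have c0 := le_trans (dot_ge0 x) H.
apply: norm_le_entry => [|i j]; first by rewrite addr_ge0.
rewrite ord1; have := le_trans (entry_le_dot x i) H.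
rewrite ler_norml => ?; apply/andP; split; nra.
Qed.

(** From [|a b| <= a^2 + b^2], summed over all pairs of entries. *)
Lemma bilinear_le p q (M : 'M[R]_(p, q)) (x : 'cV[R]_p) (y : 'cV[R]_q) :
  `|dot x (M *m y)| <= `|M| * (q%:R * dot x x + p%:R * dot y y).
Proof.
rewrite dotE; apply: (le_trans (ler_norm_sum _ _ _)).
apply: (@le_trans _ _ (\sum_(i < p) \sum_(j < q)
    `|M| * (x i 0 ^+ 2 + y j 0 ^+ 2))).
  apply: ler_sum => i _; rewrite mxE mulr_sumr (le_trans (ler_norm_sum _ _ _))//.
  apply: ler_sum => j _; rewrite mulrCA normrM ler_pM// ?entry_le_norm//.
  rewrite ler_norml; apply/andP; split; nra.
rewrite le_eqVlt; apply/predU1l.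
under eq_bigr do rewrite -mulr_sumr big_split/=.
rewrite -mulr_sumr big_split/=; congr (_ * (_ + _)).
  under eq_bigr do rewrite sumr_const card_ord -mulr_natl.
  by rewrite -mulr_sumr dotE; congr (_ * _); apply: eq_bigr => i _; rewrite expr2.
by rewrite sumr_const card_ord -[LHS]mulr_natl dotE; congr (_ * _).
Qed.

Lemma qform_le p (M : 'M[R]_p) (x : 'cV[R]_p) :
  `|qform M x| <= `|M| * (2 * p%:R) * dot x x.
Proof.
rewrite qformE (le_trans (bilinear_le _ _ _))//.
by rewrite le_eqVlt; apply/predU1l; ring.
Qed.

Lemma unitmx_ker0 p (M : 'M[R]_p) :
  (forall x : 'cV[R]_p, M *m x = 0 -> x = 0) -> M \in unitmx.
Proof.
move=> H; rewrite -unitmx_tr -row_free_unit -kermx_eq0.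
apply/eqP/row_matrixP => i; rewrite row0.
have /H/(congr1 trmx) : M *m (row i (kermx M^T))^T = 0.
  by rewrite -{1}[M]trmxK -trmx_mul -row_mul mulmx_ker row0 trmx0.
by rewrite trmxK trmx0.
Qed.

Lemma posdef_semi p (M : 'M[R]_p) : posdef M -> possemidef M.
Proof.
move=> H x; have [->|/H/ltW//] := eqVneq x 0.
by rewrite qform0.
Qed.

Lemma posdef_unit p (M : 'M[R]_p) : posdef M -> M \in unitmx.
Proof.
move=> H; apply: unitmx_ker0 => x Mx; apply/eqP; apply: contraT => /H.
by rewrite qformE Mx dot0r ltxx.
Qed.

Lemma sym_invmx p (M : 'M[R]_p) : sym M -> sym (invmx M).
Proof. by rewrite /sym trmx_inv => ->. Qed.

Lemma posdef_invmx p (M : 'M[R]_p) : sym M -> posdef M -> posdef (invmx M).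
Proof.
move=> sM H x x0; have uM := posdef_unit H.
have -> : qform (invmx M) x = qform M (invmx M *m x).
  by rewrite !qformE mulKVmx// dotC.
apply: H; apply: contra x0 => /eqP/(congr1 (mulmx M)).
by rewrite mulKVmx// mulmx0 => ->.
Qed.

Lemma posdef_shift p (M : 'M[R]_p) c x : posdef (M - c%:M) ->
  c * dot x x <= qform M x.
Proof.
move=> /posdef_semi/(_ x); rewrite qformD qformN qform_scalar; lra.
Qed.

Lemma posdef_ge p (M : 'M[R]_p) c : 0 < c ->
  (forall x, c * dot x x <= qform M x) -> posdef M.
Proof.
move=> c0 H x x0; apply: lt_le_trans (H x).
by rewrite mulr_gt0// dot_gt0.
Qed.

(* From [c |y|^2 <= y^T M y = y^T x <= c/2 |y|^2 + 1/(2c) |x|^2] with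
   [y = M^-1 x]. *)
Lemma invmx_dot_le p (M : 'M[R]_p) c : 0 < c ->
  (forall x, c * dot x x <= qform M x) -> forall x,
  dot (invmx M *m x) (invmx M *m x) <= c ^- 2 * dot x x.
Proof.
move=> c0 H x; set y := invmx M *m x.
have My : M *m y = x by rewrite mulKVmx//; exact: posdef_unit (posdef_ge c0 H).
have := H y; rewrite qformE My => Hy.
have := dot_ge0 (x - c *: y).
rewrite !(dotDl, dotDr, dotNl, dotNr, dotZl, dotZr) (dotC x y) => Hxy.
rewrite -(ler_pM2l (exprn_gt0 2 c0)) mulrA mulfV ?mul1r; last first.
  by rewrite expf_neq0// gt_eqF.
by rewrite expr2; nra.
Qed.

Lemma norm_invmx_le p (M : 'M[R]_p) c : 0 < c ->
  (forall x, c * dot x x <= qform M x) -> `|invmx M| <= 1 + c ^- 2.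
Proof.
move=> c0 H; have c2 : 0 < c ^- 2 by rewrite invr_gt0 exprn_gt0.
apply: norm_le_entry => [|i j]; first by rewrite addr_ge0// ltW.
have := invmx_dot_le c0 H (delta_mx j 0).
have -> : dot (delta_mx j 0) (delta_mx j 0 : 'cV[R]_p) = 1.
  rewrite dotE (bigD1 j)//= big1 => [|k kj]; rewrite !mxE ?eqxx ?mulr1 ?addr0//.
  by rewrite (negbTE kj) mul0r.
rewrite mulr1 => /norm_le_dot; apply: le_trans.
by rewrite -colE; have := entry_le_norm (col j (invmx M)) i 0; rewrite mxE.
Qed.

(** Polarization: [2 M_ij = q(e_i + e_j) - q(e_i) - q(e_j)], where [|e_i + e_j|^2 <= 4] because
    [|e_i - e_j|^2 >= 0]. Hence [|M_ij| <= (4 + 1 + 1) c / 2]. *)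
Lemma norm_sym_le p (M : 'M[R]_p) c : sym M ->
  (forall x, `|qform M x| <= c * dot x x) -> 0 <= c -> `|M| <= 3 * c.
Proof.
move=> sM H c0; apply: norm_le_entry => [|i j]; first by rewrite mulr_ge0.
have d k : dot (delta_mx k 0) (delta_mx k 0 : 'cV[R]_p) = 1.
  rewrite dotE (bigD1 k)//= big1 => [|l lk]; rewrite !mxE ?eqxx ?mulr1 ?addr0//.
  by rewrite (negbTE lk) mul0r.
have MiJ : dot (delta_mx i 0) (M *m delta_mx j 0) = M i j.
  rewrite dotE (bigD1 i)//= big1 => [|k ki]; rewrite -colE !mxE ?eqxx ?mul1r ?addr0//.
  by rewrite (negbTE ki) mul0r.
have := dot_ge0 (delta_mx i 0 - delta_mx j 0 : 'cV[R]_p).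
rewrite !(dotDl, dotDr, dotNl, dotNr) !d (dotC (delta_mx j 0)) => Hd.
have := H (delta_mx i 0 + delta_mx j 0); rewrite qform_add// MiJ.
rewrite !(dotDl, dotDr) !d (dotC (delta_mx j 0)).
move: (H (delta_mx i 0)) (H (delta_mx j 0)); rewrite !d !ler_norml.
move=> /andP[? ?] /andP[? ?] /andP[? ?]; apply/andP; split; nra.
Qed.

Lemma sym_qform_inj p (M N : 'M[R]_p) : sym M -> sym N ->
  (forall x, qform M x = qform N x) -> M = N.
Proof.
move=> sM sN H; apply/eqP; rewrite -subr_eq0 -normr_eq0 eq_le normr_ge0 andbT.
rewrite -(mulr0 3); apply: norm_sym_le => //.
  by rewrite /sym linearB/= sM sN.
by move=> x; rewrite qformD qformN H subrr normr0 mul0r.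
Qed.

End QuadraticForms.

(** * Linear differential equations *)

Section LinearODE.
Variable R : realType.

Lemma is_derive_dot p (x y : R -> 'cV[R]_p) (t : R) dx dy :
  is_derive t 1 x dx -> is_derive t 1 y dy ->
  is_derive t 1 (fun s => dot (x s) (y s)) (dot dx (y t) + dot (x t) dy).
Proof.
move=> Hx Hy; have /is_derive_mxP/(_ 0 0) := is_derive_mulmx (is_derive_trmx Hx) Hy.
by rewrite [X in is_derive _ _ _ X]mxE.
Qed.

Lemma is_derive_expRM (k t : R) :
  is_derive t 1 (fun s => expR (k * s)) (k * expR (k * t)).
Proof.
have dk : is_derive t 1 (fun s : R => k * s) k.
  have := is_deriveM (is_derive_cst k t (1 : R)) (is_derive_id t (1 : R)).
  by rewrite scaler0 addr0 [k *: 1]mulr1.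
have := is_derive1_comp (is_derive_expR (k * t)) dk.
by rewrite mulrC.
Qed.

(** The function [exp(- k t) g(t)] is nonincreasing. *)
Lemma gronwall_le (g dg : R -> R) (k a b : R) : a <= b ->
  (forall t : R, a <= t <= b -> is_derive t 1 g (dg t)) ->
  (forall t, a <= t <= b -> dg t <= k * g t) ->
  g b <= expR (k * (b - a)) * g a.
Proof.
move=> ab Hg Hdg.
pose f t := expR (- k * t) * g t.
pose df t := - (expR (- k * t) * dg t + g t * (- k * expR (- k * t))).
have Hf t : a <= t <= b -> is_derive t 1 (- f) (df t).
  by move=> tab; exact: is_deriveN (is_deriveM (is_derive_expRM (- k) t) (Hg t tab)).
have /= := ler_of_derive ab Hf.
rewrite [(- f) a]/(- f a) [(- f) b]/(- f b) lerN2 => /(_ _)/wrap[|H].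
  move=> t tab; have := Hdg t tab; have := expR_gt0 (- k * t).
  by rewrite /df; move: (expR _) => e e0 ?; nra.
have := expR_gt0 (k * b); move: H; rewrite /f => H e0.
have := ler_wpM2l (ltW e0) H; rewrite !mulrA -!expRD.
rewrite (_ : k * b + - k * b = 0) ?expR0 ?mul1r; last by ring.
by rewrite (_ : k * b + - k * a = k * (b - a)); last by ring.
Qed.

(** The derivative of [|y|^2] is at most [4 p c |y|^2] in absolute value. Gronwall gives the first
    bound, and applied to the time reversal [h] the second. *)
Lemma ode_gronwall p (A : R -> 'M[R]_p) (y : R -> 'cV[R]_p) (c a b : R) :
  a <= b -> (forall t, a <= t <= b -> `|A t| <= c) ->
  (forall t : R, is_derive t 1 y (A t *m y t)) ->
  dot (y b) (y b) <= expR (4 * p%:R * c * (b - a)) * dot (y a) (y a) /\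
  dot (y a) (y a) <= expR (4 * p%:R * c * (b - a)) * dot (y b) (y b).
Proof.
move=> ab Ac Hy; pose g t := dot (y t) (y t).
have Hg t : is_derive t (1 : R) g (2 * dot (y t) (A t *m y t)).
  have := is_derive_dot (Hy t) (Hy t).
  by rewrite [dot (A t *m _) _]dotC -mulr2n mulr_natl.
have Hb t : a <= t <= b -> `|2 * dot (y t) (A t *m y t)| <= 4 * p%:R * c * g t.
  move=> /Ac H; rewrite normrM ger0_norm//.
  apply: le_trans (ler_wpM2l _ (bilinear_le _ _ _)) _ => //.
  have g0 : 0 <= p%:R * g t by rewrite mulr_ge0 ?dot_ge0.
  by rewrite -/(g t); nra.
split.
- apply: (gronwall_le ab (fun t _ => Hg t)) => t /Hb.
  by rewrite ler_norml => /andP[].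
- pose h t := g (- t).
  have Hh t : is_derive t (1 : R) h (- (2 * dot (y (- t)) (A (- t) *m y (- t)))).
    have := is_derive1_comp (Hg (- t)) (is_deriveNid t 1).
    by rewrite mulrN1.
  have ba : - b <= - a by rewrite lerN2.
  have := @gronwall_le h _ (4 * p%:R * c) (- b) (- a) ba (fun t _ => Hh t).
  rewrite /h !opprK [- a + b]addrC; apply => t /andP[bt ta].
  have /Hb : a <= - t <= b by rewrite lerNr ta lerNl bt.
  by rewrite ler_norml => /andP[? ?]; rewrite lerNl.
Qed.

Lemma continuous_bounded_segment p q (F : R -> 'M[R]_(p, q)) (a b : R) :
  continuous F -> exists c, forall t, a <= t <= b -> `|F t| <= c.
Proof.
move=> cF; have [ab|ba] := leP a b; last first.
  exists 0 => t /andP[at_ tb]; have := le_trans at_ tb.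
  by rewrite leNgt ba.
have [|c cab H] := @EVT_max _ (fun t => `|F t|) a b ab.
  apply: continuous_subspaceT => t.
  exact: (continuous_comp (cF t) (@norm_continuous _ _ _)).
by exists `|F c| => t tab; apply: H; rewrite in_itv.
Qed.

(** Gronwall with zero data at [s], on each column, forwards or backwards in time. *)
Lemma ode_unique p q (A : R -> 'M[R]_p) (Y : R -> 'M[R]_(p, q)) (s : R) :
  continuous A -> (forall t : R, is_derive t 1 Y (A t *m Y t)) -> Y s = 0 ->
  forall t, Y t = 0.
Proof.
move=> cA HY Ys t; apply/matrixP => i j; rewrite mxE.
have Hc r : is_derive r (1 : R) (fun r => Y r *m delta_mx j 0)
    (A r *m (Y r *m delta_mx j 0) : 'cV[R]_p).
  by rewrite mulmxA; apply: is_derive_mulmxr.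
suff /dot_eq0/matrixP/(_ i 0) : dot (Y t *m delta_mx j 0) (Y t *m delta_mx j 0) = 0.
  by rewrite -colE !mxE.
apply/eqP; rewrite eq_le dot_ge0 andbT.
have [st|/ltW ts] := leP s t.
- have [c Hc'] := continuous_bounded_segment s t cA.
  have [] := ode_gronwall st Hc' Hc.
  by rewrite Ys mul0mx dot0l mulr0.
- have [c Hc'] := continuous_bounded_segment t s cA.
  have [_] := ode_gronwall ts Hc' Hc.
  by rewrite Ys mul0mx dot0l mulr0.
Qed.

Section Transition.
Variables (n : nat) (A : R -> 'M[R]_n) (Phi : R -> R -> 'M[R]_n).
Hypotheses (cA : continuous A) (HPhi : is_transition A Phi).

Lemma transition_id s : Phi s s = 1%:M.
Proof. by have [] := HPhi s. Qed.

Lemma transition_derive s (t : R) :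
  is_derive t 1 (Phi^~ s) (A t *m Phi t s).
Proof. by have [] := HPhi s. Qed.

Lemma ode_transition q (Y : R -> 'M[R]_(n, q)) s :
  (forall t : R, is_derive t 1 Y (A t *m Y t)) ->
  forall t, Y t = Phi t s *m Y s.
Proof.
move=> HY t; apply/eqP; rewrite -subr_eq0; apply/eqP.
apply: (@ode_unique _ _ A (fun t => Y t - Phi t s *m Y s) s cA).
  move=> r; rewrite mulmxBr mulmxA.
  exact: (is_deriveB (HY r) (is_derive_mulmxr _ (transition_derive s r))).
by rewrite transition_id mul1mx subrr.
Qed.

Lemma transition_cocycle t s r : Phi t s *m Phi s r = Phi t r.
Proof. by rewrite -(ode_transition s (transition_derive r)). Qed.

Lemma transition_inv t s : Phi t s *m Phi s t = 1%:M.
Proof. by rewrite transition_cocycle transition_id. Qed.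

Lemma transition_unit t s : Phi t s \in unitmx.
Proof. by have [] := mulmx1_unit (transition_inv t s). Qed.

Lemma invmx_transition t s : invmx (Phi t s) = Phi s t.
Proof.
by rewrite -[LHS]mulmx1 -(transition_inv t s) mulKmx// transition_unit.
Qed.

Lemma transition_derive_r s (t : R) :
  is_derive t 1 (Phi s) (- (Phi s t *m A t)).
Proof.
have H := is_derive_invmx (fun r => transition_unit r s) (transition_derive s t).
move: H; rewrite invmx_transition -!mulmxA transition_inv mulmx1.
by rewrite (_ : (fun x => invmx (Phi x s)) = Phi s)//; apply/funext => r;
  rewrite invmx_transition.
Qed.

Lemma smooth_transition s : smooth A -> smooth (Phi^~ s).
Proof.
move=> /smoothP sA; apply: (smooth_bootstrap (transition_derive s)) => k H.
exact: nsmooth_mulmx.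
Qed.

Lemma smooth_transition_r s : smooth A -> smooth (Phi s).
Proof.
move=> /smoothP sA; apply: (smooth_bootstrap (transition_derive_r s)) => k H.
by apply: nsmoothN; exact: nsmooth_mulmx.
Qed.

(** The columns solve the equation from unit vectors; as [A] is bounded on the whole line, Gronwall
    bounds them by the distance of the two times alone. *)
Lemma transition_bounded s0 : bounded_mx A ->
  bounded_family [set ts : R * R | `|ts.1 - ts.2| <= s0]
    (fun ts => Phi ts.1 ts.2).
Proof.
move=> [c Hc]; exists (1 + expR (4 * n%:R * `|c| * s0)) => -[t s]/= ts.
apply: norm_le_entry => [|i j]; first by rewrite addr_ge0// expR_ge0.
have Hy r : is_derive r (1 : R) (fun r => Phi r s *m delta_mx j 0)
    (A r *m (Phi r s *m delta_mx j 0) : 'cV[R]_n).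
  by rewrite mulmxA; apply: is_derive_mulmxr; exact: transition_derive.
have dj : dot (delta_mx j 0) (delta_mx j 0 : 'cV[R]_n) = 1.
  rewrite dotE (bigD1 j)//= big1 => [|l lj]; rewrite !mxE ?eqxx ?mulr1 ?addr0//.
  by rewrite (negbTE lj) mul0r.
suff /norm_le_dot : dot (Phi t s *m delta_mx j 0) (Phi t s *m delta_mx j 0) <=
    expR (4 * n%:R * `|c| * s0).
  apply: le_trans; rewrite -colE.
  by have := entry_le_norm (col j (Phi t s)) i 0; rewrite mxE.
have Hc' r : `|A r| <= `|c| by rewrite (le_trans (Hc r))// ler_norm.
have k0 : 0 <= 4 * n%:R * `|c| by rewrite !mulr_ge0.
have [st|/ltW ts'] := leP s t.
- have [+ _] := ode_gronwall st (fun r _ => Hc' r) Hy.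
  rewrite transition_id mul1mx dj mulr1 => /le_trans; apply.
  by rewrite ler_expR ler_wpM2l//; rewrite ger0_norm ?subr_ge0// in ts.
- have [_] := ode_gronwall ts' (fun r _ => Hc' r) Hy.
  rewrite transition_id mul1mx dj mulr1 => /le_trans; apply.
  by rewrite ler_expR ler_wpM2l//; rewrite distrC ger0_norm ?subr_ge0// in ts.
Qed.

End Transition.

End LinearODE.

(** * Decay, integration and Lipschitz estimates *)

Lemma bounded_family_sub (R : realType) (T T' : Type) (D : set T) (D' : set T')
    p q (F : T' -> 'M[R]_(p, q)) (f : T -> T') :
  bounded_family D' F -> (forall x, D x -> D' (f x)) ->
  bounded_family D (fun x => F (f x)).
Proof. by move=> [a Ha] H; exists a => x /H; exact: Ha. Qed.

Lemma expR_decay_le0 (R : realType) (x c b : R) : 0 < b ->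
  (forall r, 0 <= r -> x <= c * expR (- b * r)) -> x <= 0.
Proof.
move=> b0 H; rewrite leNgt; apply/negP => x0.
have c0 : 0 < c.
  have := H 0 (lexx _); rewrite mulr0 expR0 mulr1; exact: lt_le_trans.
(* At [r = c / (x b)], the bound [exp(b r) >= 1 + c / x] turns the hypothesis into [x + c <= c]. *)
have r0 : 0 <= c / (x * b) by rewrite divr_ge0 ?mulr_ge0// ltW.
have := H _ r0; have := expR_ge1Dx (b * (c / (x * b))).
have -> : b * (c / (x * b)) = c / x by field; rewrite !gt_eqF.
have -> : - b * (c / (x * b)) = - (c / x) by field; rewrite !gt_eqF.
rewrite expRN => H1 H2.
have e0 := expR_gt0 (c / x); move: H1 H2; move: (expR _) e0 => e e0 H1 H2.
have : x * e <= c by rewrite -ler_pdivlMr.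
have : x * (1 + c / x) <= x * e by rewrite ler_pM2l.
rewrite mulrDr mulrCA divff ?gt_eqF// !mulr1; lra.
Qed.

Lemma mxint_derive (R : realType) p q (f : R -> 'M[R]_(p, q)) (a t : R) :
  continuous f -> is_derive t 1 (fun x => mxint a x f) (f t).
Proof.
move=> cf; have [F HF] := mx_primitive_exists cf.
rewrite (_ : (fun x => _) = F - cst (F a)); last first.
  by apply/funext => x; rewrite (mxint_FTC a x HF cf).
by have := is_deriveB (HF t) (is_derive_cst (F a) t (1 : R)); rewrite subr0.
Qed.

Lemma mxint_id (R : realType) p q (f : R -> 'M[R]_(p, q)) (a : R) :
  mxint a a f = 0.
Proof.
apply/matrixP => i j; rewrite !mxE /oint lexx.
by rewrite set_itv1 Rintegral_set1.
Qed.

(** Entrywise, [F_ij + c t] and [c t - F_ij] are nondecreasing on the segment. *)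
Lemma mx_lipschitz (R : realType) p q (F dF : R -> 'M[R]_(p, q)) (a b c : R) :
  a <= b -> 0 <= c -> (forall t : R, is_derive t 1 F (dF t)) ->
  (forall t, a <= t <= b -> `|dF t| <= c) -> `|F b - F a| <= c * (b - a).
Proof.
move=> ab c0 HF Hc; apply: norm_le_entry => [|i j].
  by rewrite mulr_ge0// subr_ge0.
rewrite mxDE mxNE.
have HFij t : is_derive t (1 : R) (fun x => F x i j) (dF t i j).
  by have /is_derive_mxP := HF t; exact.
have Hij t : a <= t <= b -> - c <= dF t i j <= c.
  by move=> /Hc H; rewrite -ler_norml; exact: le_trans (entry_le_norm _ _ _) H.
have Hlin t : is_derive t (1 : R) (fun x : R => c * x) c.
  have := is_deriveM (is_derive_cst c t (1 : R)) (is_derive_id t (1 : R)).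
  by rewrite scaler0 addr0 [c *: 1]mulr1.
have HD t : is_derive t (1 : R) (fun x => F x i j + c * x) (dF t i j + c).
  exact: is_deriveD (HFij t) (Hlin t).
have HB t : is_derive t (1 : R) (fun x => c * x - F x i j) (c - dF t i j).
  exact: is_deriveB (Hlin t) (HFij t).
rewrite ler_norml; apply/andP; split.
- have /= H := ler_of_derive ab (fun t _ => HD t).
  suff : F a i j + c * a <= F b i j + c * b by lra.
  by apply: H => t /Hij/andP[]; lra.
- have /= H := ler_of_derive ab (fun t _ => HB t).
  suff : c * a - F a i j <= c * b - F b i j by lra.
  by apply: H => t /Hij/andP[]; lra.
Qed.

(** * Transport along a Sylvester equation *)

Section Sylvester.
Variables (R : realType) (n : nat).
Variables (A1 A2 : R -> 'M[R]_n) (Phi1 Phi2 : R -> R -> 'M[R]_n).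
Hypotheses (T1 : is_transition A1 Phi1) (T2 : is_transition A2 Phi2).
Variable D : R -> 'M[R]_n.
Hypothesis HD : forall t : R,
  is_derive t 1 D (- (D t *m A1 t) - (A2 t)^T *m D t).

(** The product [Phi2(r,t)^T D(r) Phi1(r,t)] does not depend on [r]; compare [r = t] and [r = s]. *)
Lemma sylvester_transport s t : D t = (Phi2 s t)^T *m D s *m Phi1 s t.
Proof.
rewrite -[LHS]mulmx1 -[LHS]mul1mx -[X in X *m _]trmx1.
rewrite -{1}(transition_id T2 t) -(transition_id T1 t) mulmxA.
apply: (@derive0_cst _ _ _ (fun r => (Phi2 r t)^T *m D r *m Phi1 r t)) => x.
have H1 := transition_derive T1 t x; have H2 := transition_derive T2 t x.
have := is_derive_mulmx (is_derive_mulmx (is_derive_trmx H2) (HD x)) H1.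
rewrite trmx_mul !(mulmxDl, mulmxDr, mulNmx, mulmxN) !mulmxA.
set a := _ *m _ *m _ *m _; set b := _ *m _ *m _ *m _.
by rewrite (_ : b + (- a - b) + a = 0)//; apply/matrixP => i j;
  rewrite !(mxDE, mxNE) mx0E; ring.
Qed.

End Sylvester.

(** * Riccati equations *)

Section Riccati.
Variables (R : realType) (n m : nat).
Variables (A : R -> 'M[R]_n) (B : R -> 'M[R]_(n, m)).
Variables (Q : R -> 'M[R]_n) (S : R -> 'M[R]_(n, m)) (Rm : R -> 'M[R]_m).
Hypotheses (sA : smooth A) (sB : smooth B).
Hypotheses (sQ : smooth Q) (sS : smooth S) (sR : smooth Rm).
Hypotheses (symR : forall t, sym (Rm t)) (pR : forall t, posdef (Rm t)).

Lemma unit_Rm t : Rm t \in unitmx. Proof. exact: posdef_unit. Qed.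

Lemma riccati_smooth P : riccati_solution A B Q S Rm P -> smooth P.
Proof.
move=> HP; apply: (smooth_bootstrap (fun t => (HP t).2)) => k sP.
have /smoothP/(_ k) sI := smooth_invmx unit_Rm sR.
move/smoothP: sA => /(_ k) sAk; move/smoothP: sB => /(_ k) sBk.
move/smoothP: sQ => /(_ k) sQk; move/smoothP: sS => /(_ k) sSk.
repeat first [apply: nsmoothD | apply: nsmoothN | apply: nsmooth_mulmx
  | apply: nsmooth_trmx | assumption].
Qed.

Lemma closed_loop_smooth P : riccati_solution A B Q S Rm P ->
  smooth (closed_loop A B S Rm P).
Proof.
move=> /riccati_smooth sP; have sI := smooth_invmx unit_Rm sR.
apply: (smoothB sA); apply: smooth_mulmx; first exact: smooth_mulmx.
apply: smoothD; first exact: smooth_trmx.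
by apply: smooth_mulmx => //; exact: smooth_trmx.
Qed.

(** With [G_i = S^T + B^T P_i], the difference of the quadratic terms is [(G_1 - G_2)^T R^-1 G_1 +
    G_2^T R^-1 (G_1 - G_2)], and [G_1 - G_2 = B^T (P_1 - P_2)]. The difference of two solutions thus
    obeys a Sylvester equation with one closed loop on each side. *)
Lemma riccati_diff P1 P2 : riccati_solution A B Q S Rm P1 ->
  riccati_solution A B Q S Rm P2 -> forall t : R,
  is_derive t 1 (fun t => P1 t - P2 t)
   (- ((P1 t - P2 t) *m closed_loop A B S Rm P1 t)
    - (closed_loop A B S Rm P2 t)^T *m (P1 t - P2 t)).
Proof.
move=> H1 H2 t; have [s1 d1] := H1 t; have [s2 d2] := H2 t.
apply: is_derive_eq (is_deriveB d1 d2) _.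
have E P : sym P -> P *m B t + S t = ((S t)^T + (B t)^T *m P)^T.
  by move=> sP; rewrite linearD/= trmxK trmx_mul trmxK sP addrC.
have E' P : (B t)^T *m P + (S t)^T = (S t)^T + (B t)^T *m P by rewrite addrC.
have EB : (P1 t - P2 t) *m B t =
    ((S t)^T + (B t)^T *m P1 t)^T - ((S t)^T + (B t)^T *m P2 t)^T.
  by rewrite -!E// mulmxBl opprD addrACA subrr addr0.
have EB' : (B t)^T *m (P1 t - P2 t) =
    ((S t)^T + (B t)^T *m P1 t) - ((S t)^T + (B t)^T *m P2 t).
  by rewrite mulmxBr opprD addrACA subrr add0r.
rewrite !E// !E' /closed_loop.
set G1 := _ + _ *m P1 t in EB EB' *; set G2 := _ + _ *m P2 t in EB EB' *.
have -> : (P1 t - P2 t) *m (A t - B t *m invmx (Rm t) *m G1) =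
    (P1 t - P2 t) *m A t - (G1^T - G2^T) *m invmx (Rm t) *m G1.
  by rewrite mulmxBr !mulmxA EB.
have -> : (A t - B t *m invmx (Rm t) *m G2)^T *m (P1 t - P2 t) =
    (A t)^T *m (P1 t - P2 t) - G2^T *m invmx (Rm t) *m (G1 - G2).
  rewrite trmxB mulmxBl 2!trmx_mul (sym_invmx (symR t)) -EB'.
  by rewrite !mulmxA.
rewrite !(mulmxDl, mulmxDr, mulmxN, mulNmx).
by apply/matrixP => i j; rewrite !(mxDE, mxNE); ring.
Qed.

Lemma closed_loop_diff P1 P2 t :
  closed_loop A B S Rm P2 t - closed_loop A B S Rm P1 t =
  B t *m invmx (Rm t) *m (B t)^T *m (P1 t - P2 t).
Proof.
rewrite /closed_loop !(mulmxDl, mulmxDr, mulmxN) !mulmxA.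
by apply/matrixP => i j; rewrite !(mxDE, mxNE); ring.
Qed.

(** Completion of the square in [u]: the derivative of [x^T P x] plus the running cost is a square
    weighted by [R]. Test trajectories of known cost then give bounds on [P]. *)
Lemma riccati_dissipation P (x : R -> 'cV[R]_n) (u : R -> 'cV[R]_m) :
  riccati_solution A B Q S Rm P -> forall t : R,
  is_derive t 1 x (A t *m x t + B t *m u t) ->
  is_derive t 1 (fun t => qform (P t) (x t))
    (qform (Rm t) (u t + invmx (Rm t) *m ((S t)^T + (B t)^T *m P t) *m x t)
     - quadratic_cost Q S Rm t (x t) (u t)).
Proof.
move=> HP t Hx; have [sP dP] := HP t.
under eq_fun do rewrite qformE.
apply: is_derive_eq (is_derive_dot Hx (is_derive_mulmx dP Hx)) _.
have E : P t *m B t + S t = ((S t)^T + (B t)^T *m P t)^T.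
  by rewrite linearD/= trmxK trmx_mul trmxK sP addrC.
have [G EG] : exists G, G = (S t)^T + (B t)^T *m P t by eexists.
rewrite E [(B t)^T *m P t + _]addrC -EG; rewrite -EG in E.
set v := invmx (Rm t) *m G *m x t.
have Rv : Rm t *m v = G *m x t by rewrite /v -mulmxA mulKVmx// unit_Rm.
rewrite /quadratic_cost (qform_add _ _ (symR t)) Rv.
have -> : qform (Rm t) v = dot v (G *m x t) by rewrite qformE Rv.
have -> : ((x t)^T *m S t *m u t) 0 0 = dot (x t) (S t *m u t).
  by rewrite /dot mulmxA.
have -> : dot (x t) (S t *m u t) =
    dot (u t) (G *m x t) - dot (x t) (P t *m (B t *m u t)).
  rewrite [dot (u t) _]dotC dot_mulmx -E mulmxDl dotDr mulmxA; ring.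
rewrite !(mulmxDl, mulmxDr, mulNmx, dotDl, dotDr, dotNr).
have -> : dot (B t *m u t) (P t *m x t) = dot (x t) (P t *m (B t *m u t)).
  by rewrite dotC dot_mulmx sP.
have -> : dot (A t *m x t) (P t *m x t) = dot (x t) ((A t)^T *m P t *m x t).
  by rewrite dot_mulmx mulmxA.
have -> : dot (x t) (G^T *m invmx (Rm t) *m G *m x t) = dot v (G *m x t).
  by rewrite [RHS]dotC dot_mulmx /v !mulmxA.
rewrite [qform (Q t) _]qformE -(mulmxA (P t) (A t)); ring.
Qed.

Hypotheses (bA : bounded_mx A) (bB : bounded_mx B).
Hypotheses (bQ : bounded_mx Q) (bS : bounded_mx S) (bR : bounded_mx Rm).
Variables (PhiA : R -> R -> 'M[R]_n).
Hypothesis (hPhiA : is_transition A PhiA).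
Variables (s beta : R) (s0 : 0 < s) (beta0 : 0 < beta).

Let W t0 t := mxint t0 t
  (fun r => PhiA t0 r *m B r *m (B r)^T *m (PhiA t0 r)^T).
Hypothesis gramian : forall t, posdef (W t (t + s) - beta%:M).

Let window := [set ts : R * R | ts.1 <= ts.2 <= ts.1 + s].

Let cA : continuous A. Proof. exact: smooth_continuous. Qed.

Lemma gramian_integrand_continuous t0 :
  continuous (fun r => PhiA t0 r *m B r *m (B r)^T *m (PhiA t0 r)^T).
Proof.
apply: smooth_continuous; have sPhi := @smooth_transition_r _ _ _ _ cA hPhiA t0 sA.
apply: smooth_mulmx; last exact: smooth_trmx.
apply: smooth_mulmx; last exact: smooth_trmx.
exact: smooth_mulmx.
Qed.

Lemma gramian_derive t0 (t : R) : is_derive t 1 (W t0)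
  (PhiA t0 t *m B t *m (B t)^T *m (PhiA t0 t)^T).
Proof. exact: (mxint_derive t0 t (@gramian_integrand_continuous t0)). Qed.

Lemma window_transition : bounded_family window (fun ts => PhiA ts.1 ts.2).
Proof.
have := transition_bounded hPhiA s bA.
move=> [c H]; exists c => ts /andP[h1 h2]; apply: H => /=.
by rewrite distrC ger0_norm ?subr_ge0// lerBlDl.
Qed.

Lemma window_transition_rev :
  bounded_family window (fun ts => PhiA ts.2 ts.1).
Proof.
have := transition_bounded hPhiA s bA.
move=> [c H]; exists c => ts /andP[h1 h2]; apply: (H (ts.2, ts.1)) => /=.
by rewrite ger0_norm ?subr_ge0// lerBlDl.
Qed.

(** The Gramian vanishes at [t = t0] and has bounded derivative on the window. *)
Lemma window_gramian : bounded_family window (fun ts => W ts.1 ts.2).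
Proof.
have [c Hc] : bounded_family window (fun ts =>
    PhiA ts.1 ts.2 *m B ts.2 *m (B ts.2)^T *m (PhiA ts.1 ts.2)^T).
  have b1 := window_transition.
  have b2 : bounded_family window (fun ts => B ts.2).
    exact: bounded_family_comp.
  apply: bounded_familyM; last exact: bounded_familyT.
  apply: bounded_familyM; last exact: bounded_familyT.
  exact: bounded_familyM.
exists (`|c| * s) => -[t0 t]/= /andP[h1 h2].
rewrite -[W t0 t]subr0 -(mxint_id (fun r =>
  PhiA t0 r *m B r *m (B r)^T *m (PhiA t0 r)^T) t0).
apply: (@le_trans _ _ (`|c| * (t - t0))).
  apply: (mx_lipschitz h1 (normr_ge0 c) (@gramian_derive t0)) => r /andP[r1 r2].
  apply: le_trans (ler_norm c); apply: (Hc (t0, r)); rewrite /window/= r1/=.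
  exact: le_trans r2 h2.
by rewrite ler_wpM2l// lerBlDl.
Qed.

(* [x^T P x] decreases along a trajectory at most at the rate of its cost. *)
Lemma riccati_transfer P (X : R -> R -> 'M[R]_n) (U : R -> R -> 'M[R]_(m, n)) :
  riccati_solution A B Q S Rm P ->
  bounded_family window (fun ts => X ts.1 ts.2) ->
  bounded_family window (fun ts => U ts.1 ts.2) ->
  (forall t0 (t : R),
    is_derive t 1 (X t0) (A t *m X t0 t + B t *m U t0 t)) ->
  exists C, 0 <= C /\ forall t x, qform (P t) (X t t *m x) <=
    qform (P (t + s)) (X t (t + s) *m x) + C * dot x x.
Proof.
move=> HP bX bU HX.
(* As a quadratic form in [x], this matrix is the running cost along the state [X x] with input
   [U x]. *)
have [c Hc] : bounded_family window (fun ts =>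
    (X ts.1 ts.2)^T *m Q ts.2 *m X ts.1 ts.2 +
    ((X ts.1 ts.2)^T *m S ts.2 *m U ts.1 ts.2 +
     (X ts.1 ts.2)^T *m S ts.2 *m U ts.1 ts.2) +
    (U ts.1 ts.2)^T *m Rm ts.2 *m U ts.1 ts.2).
  have bXT := bounded_familyT bX; have bUT := bounded_familyT bU.
  have bQ' : bounded_family window (fun ts => Q ts.2).
    exact: bounded_family_comp.
  have bS' : bounded_family window (fun ts => S ts.2).
    exact: bounded_family_comp.
  have bR' : bounded_family window (fun ts => Rm ts.2).
    exact: bounded_family_comp.
  by repeat first [assumption | apply: bounded_familyD | apply: bounded_familyM].
pose k := `|c| * (2 * n%:R); have k0 : 0 <= k by rewrite !mulr_ge0.
exists (k * s); split; first by rewrite mulr_ge0// ltW.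
move=> t0 x; pose xx t := X t0 t *m x; pose u t := U t0 t *m x.
have Hxx (t : R) : is_derive t 1 xx (A t *m xx t + B t *m u t).
  have := is_derive_mulmxr x (HX t0 t).
  by rewrite mulmxDl -!mulmxA.
have cost_le t : t0 <= t <= t0 + s ->
    quadratic_cost Q S Rm t (xx t) (u t) <= k * dot x x.
  move=> w; have /= := Hc (t0, t) w.
  set M := (X in `|X| <= _) => HM.
  have -> : quadratic_cost Q S Rm t (xx t) (u t) = qform M x.
    rewrite /M !qformD !qform_mulmx /quadratic_cost; congr (_ + _ + _).
    rewrite -mulr2n -[RHS]mulr_natl; congr (_ * _).
    by rewrite /qform /xx /u trmx_mul !mulmxA.
  rewrite (le_trans (ler_norm _))// (le_trans (qform_le _ _))//.
  rewrite ler_wpM2r ?dot_ge0// ler_wpM2r ?mulr_ge0//.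
  exact: le_trans HM (ler_norm _).
have ts0 : t0 <= t0 + s by rewrite lerDl ltW.
have Hlin (t : R) : is_derive t (1 : R) (fun t => k * dot x x * t) (k * dot x x).
  have := is_deriveM (is_derive_cst (k * dot x x) t (1 : R)) (is_derive_id t (1 : R)).
  by rewrite scaler0 addr0 [_ *: 1]mulr1.
have Hg (t : R) := is_deriveD (riccati_dissipation HP (Hxx t)) (Hlin t).
have H := ler_of_derive ts0 (fun t _ => Hg t).
have {H} : qform (P t0) (xx t0) + k * dot x x * t0 <=
    qform (P (t0 + s)) (xx (t0 + s)) + k * dot x x * (t0 + s).
  apply: H => t /cost_le Hcost.
  have := posdef_semi (pR t)
    (u t + invmx (Rm t) *m ((S t)^T + (B t)^T *m P t) *m xx t); lra.
rewrite -/(xx _) -/(xx _); lra.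
Qed.

(** By variation of constants, the input [B(t)^T Phi_A(t0,t)^T N x] takes the state from [M x] to
    [Phi_A(t,t0) (M + W N) x]. The choice of [M] and [N] fixes both ends of the trajectory. *)
Lemma riccati_steer P (M N : R -> 'M[R]_n) :
  riccati_solution A B Q S Rm P -> bounded_mx M -> bounded_mx N ->
  exists C, 0 <= C /\ forall t x, qform (P t) (M t *m x) <=
    qform (P (t + s)) (PhiA (t + s) t *m (M t + W t (t + s) *m N t) *m x)
    + C * dot x x.
Proof.
move=> HP bM bN.
have [|||C [C0 HC]] := @riccati_transfer P
  (fun t0 t => PhiA t t0 *m (M t0 + W t0 t *m N t0))
  (fun t0 t => (B t)^T *m (PhiA t0 t)^T *m N t0) HP.
- apply: bounded_familyM; first exact: window_transition_rev.
  apply: bounded_familyD; first exact: bounded_family_comp.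
  apply: bounded_familyM; first exact: window_gramian.
  exact: bounded_family_comp.
- apply: bounded_familyM; last exact: bounded_family_comp.
  apply: bounded_familyM; apply: bounded_familyT; last exact: window_transition.
  exact: bounded_family_comp.
- move=> t0 t.
  have H := is_derive_mulmx (transition_derive hPhiA t0 t)
    (is_deriveD (is_derive_cst (M t0) t (1 : R))
      (is_derive_mulmxr (N t0) (gramian_derive t0 t))).
  apply: is_derive_eq H _; rewrite add0r -!mulmxA; congr (_ + _).
  by rewrite (mulmxA (PhiA t t0)) (transition_inv cA hPhiA) mul1mx.
exists C; split=> // t x; have := HC t x.
by rewrite (transition_id hPhiA) mul1mx /W mxint_id mul0mx addr0.
Qed.

Lemma riccati_bounded P : riccati_solution A B Q S Rm P -> bounded_mx P.
Proof.
move=> HP; pose V t := invmx (W t (t + s)).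
have WV t : W t (t + s) *m V t = 1%:M.
  apply: mulmxV; apply: posdef_unit; apply: (posdef_ge beta0) => x.
  exact: posdef_shift (gramian t).
have bV : bounded_mx V.
  exists (1 + beta ^- 2) => t; apply: norm_invmx_le => // x.
  exact: posdef_shift (gramian t).
have b1 : bounded_mx (fun _ : R => 1%:M : 'M[R]_n) by exists `|1%:M : 'M[R]_n|.
have b0 : bounded_mx (fun _ : R => 0 : 'M[R]_n) by exists `|0 : 'M[R]_n|.
have bVN : bounded_mx (fun t => - V t).
  by case: bV => c Hc; exists c => t; rewrite normrN.
have bVP : bounded_mx (fun t => V t *m PhiA t (t + s)).
  apply: bounded_mxE; apply: bounded_familyM.
    by case: bV => c Hc; exists c => t _; exact: Hc.
  apply: (@bounded_family_sub _ _ _ _ _ _ _ _ (fun t => (t, t + s)) window_transition).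
  by move=> t _; rewrite /window/= lexx lerDl ltW.
(* [N = - W^-1] steers [x] to 0, which bounds the form of [P] from above at the start of the
   window. *)
have [C1 [C10 H1]] := riccati_steer HP b1 bVN.
(* [N = W^-1 Phi_A(t,t+s)] steers 0 to [x], which bounds it from below at the end of the window;
   hence the use at [t - s] afterwards. *)
have [C2 [C20 H2]] := riccati_steer HP b0 bVP.
exists (3 * (C1 + C2)) => t; apply: norm_sym_le; last by rewrite addr_ge0.
  by have [] := HP t.
move=> x; have d0 := dot_ge0 x.
have := H1 t x; rewrite mul1mx mulmxN WV subrr mulmx0 mul0mx qform0 add0r => h1.
have := H2 (t - s) x; rewrite subrK mul0mx qform0 add0r.
rewrite [W _ _ *m _]mulmxA -{1}[t in W _ t](subrK s) WV mul1mx.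
rewrite (transition_inv cA hPhiA) mul1mx => h2.
by rewrite ler_norml; apply/andP; split; nra.
Qed.

End Riccati.

(** * Sylvester equations with stable or antistable coefficients *)

Section Stability.
Variables (R : realType) (n : nat).

(* [D t = Phi2(T,t)^T D(T) Phi1(T,t)] tends to 0 as [T] grows. *)
Lemma sylvester_stable0 (A1 A2 D : R -> 'M[R]_n) :
  exp_stable A1 -> exp_stable A2 -> bounded_mx D ->
  (forall t : R, is_derive t 1 D (- (D t *m A1 t) - (A2 t)^T *m D t)) ->
  forall t, D t = 0.
Proof.
move=> [Phi1 [T1 [a1 [b1 [a10 b10 S1]]]]] [Phi2 [T2 [a2 [b2 [a20 b20 S2]]]]].
move=> [d Hd] HD t; apply/eqP; rewrite -normr_eq0 eq_le normr_ge0 andbT.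
pose c := n%:R * (n%:R * a2 * `|d|) * a1.
apply: (@expR_decay_le0 _ _ c (b1 + b2)); first by rewrite addr_gt0.
move=> r r0; rewrite (sylvester_transport T1 T2 HD (t + r) t).
have tr : t <= t + r by rewrite lerDl.
have := S1 _ _ tr; have := S2 _ _ tr; rewrite addrAC subrr add0r => h2 h1.
have -> : - (b1 + b2) * r = - b2 * r + - b1 * r by ring.
rewrite expRD; apply: le_trans (norm_mulmx _ _) _.
have nM : `|(Phi2 (t + r) t)^T *m D (t + r)| <=
    n%:R * (a2 * expR (- b2 * r)) * `|d|.
  apply: le_trans (norm_mulmx _ _) _; rewrite norm_trmx.
  apply: ler_pM => //; first by rewrite ler_wpM2l.
  exact: le_trans (Hd _) (ler_norm _).
have -> : c * (expR (- b2 * r) * expR (- b1 * r)) =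
    n%:R * (n%:R * (a2 * expR (- b2 * r)) * `|d|) * (a1 * expR (- b1 * r)).
  by rewrite /c; ring.
by apply: ler_pM => //; rewrite ler_wpM2l.
Qed.

(* On the kernel of [D] the two flows coincide, and a common trajectory that
   decays both forwards and backwards in time vanishes. *)
Lemma sylvester_unit (Ap Am D N : R -> 'M[R]_n) :
  continuous Ap -> continuous Am -> exp_stable Ap -> exp_antistable Am ->
  (forall t : R, is_derive t 1 D (- (D t *m Am t) - (Ap t)^T *m D t)) ->
  (forall t, Am t - Ap t = N t *m D t) ->
  forall t, D t \in unitmx.
Proof.
move=> cp cm [Phip [Tp [a1 [b1 [a10 b10 S1]]]]] [Phim [Tm [a2 [b2 [a20 b20 S2]]]]].
move=> HD HN t0; apply: unitmx_ker0 => x Dx.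
have Dy t : D t *m (Phim t t0 *m x) = 0.
  rewrite (sylvester_transport Tm Tp HD t0 t) mulmxA -(mulmxA _ (Phim t0 t)).
  by rewrite (transition_inv cm Tm) mulmx1 -mulmxA Dx mulmx0.
have Hy (t : R) : is_derive t 1 (fun t => Phim t t0 *m x)
    (Ap t *m (Phim t t0 *m x)).
  apply: is_derive_eq (is_derive_mulmxr x (transition_derive Tm t0 t)) _.
  rewrite -[Am t in LHS](subrK (Ap t)) HN -mulmxA mulmxDl -(mulmxA (N t)).
  by rewrite Dy mulmx0 add0r.
(* The motion goes from [t0] to [t] along [Am] and returns along [Ap]; at [t = t0 - r] both factors
   decay in [r]. *)
have E t : x = Phip t0 t *m (Phim t t0 *m x).
  rewrite (ode_transition cp Tp t0 Hy t) mulmxA (transition_inv cp Tp).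
  by rewrite (transition_id Tm) !mul1mx.
apply/eqP; rewrite -normr_eq0 eq_le normr_ge0 andbT.
pose c := n%:R * a1 * (n%:R * a2 * `|x|).
apply: (@expR_decay_le0 _ _ c (b1 + b2)); first by rewrite addr_gt0.
move=> r r0; have tr : t0 - r <= t0 by rewrite lerBlDr lerDl.
have := S1 _ _ tr; have := S2 _ _ tr.
have -> : t0 - (t0 - r) = r by ring.
have -> : b2 * (t0 - r - t0) = - (b2 * r) by ring.
move=> h2 h1; rewrite {1}(E (t0 - r)).
have -> : c * expR (- (b1 + b2) * r) =
    n%:R * (a1 * expR (- b1 * r)) * (n%:R * (a2 * expR (- (b2 * r))) * `|x|).
  have -> : - (b1 + b2) * r = - (b2 * r) + - b1 * r by ring.
  by rewrite expRD /c; ring.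
apply: le_trans (norm_mulmx _ _) _; apply: ler_pM => //.
  by rewrite ler_wpM2l.
apply: le_trans (norm_mulmx _ _) _; apply: ler_pM => //.
by rewrite ler_wpM2l.
Qed.

End Stability.

(** * Pencils of symmetric matrices *)

Section Pencil.
Variable R : realType.

(* With [y = S^-1 x] and [c > 0] such that [y^T S y <= c |x|^2], nonnegativity of
   [S] at [c x - y] gives [|x|^2 <= c x^T S x]. *)
Lemma psd_unit_coercive p (S : 'M[R]_p) : sym S -> possemidef S ->
  S \in unitmx -> exists e, 0 < e /\ forall x, e * dot x x <= qform S x.
Proof.
move=> sS S0 uS; pose c := `|invmx S| * (2 * p%:R) + 1.
have c0 : 0 < c by rewrite ltr_wpDl// !mulr_ge0.
exists c^-1; split; first by rewrite invr_gt0.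
move=> x; rewrite ler_pdivrMl//; pose y := - (invmx S *m x).
have yx : qform S y <= c * dot x x.
  have -> : qform S y = qform (invmx S) x.
    by rewrite !qformE /y mulmxN mulKVmx// dotNl dotNr opprK dotC.
  rewrite (le_trans (ler_norm _))// (le_trans (qform_le _ _))//.
  by rewrite ler_wpM2r ?dot_ge0// /c lerDl.
have := S0 (c *: x + y); rewrite qform_add// /y mulmxN mulKVmx// -/y.
have -> : qform S (c *: x) = c ^+ 2 * qform S x.
  by rewrite !qformE -scalemxAr dotZl dotZr; ring.
rewrite dotNr dotZl => H.
by rewrite -(ler_pM2l c0); nra.
Qed.

(** The least [v] with [S1 <= v S2] is an eigenvalue of the pencil: [v S2 - S1] is nonnegative, and
    were it invertible it would be coercive, so that [v] could be lowered. Hence [v <= mu]. *)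
Lemma pencil_le p (S1 S2 : 'M[R]_p) mu : sym S1 -> posdef S1 ->
  sym S2 -> posdef S2 ->
  (forall l (x : 'cV[R]_p), x != 0 -> S1 *m x = l *: (S2 *m x) -> l <= mu) ->
  forall x, qform S1 x <= mu * qform S2 x.
Proof.
move=> s1 p1 s2 p2 H x0.
have [->|x0n] := eqVneq x0 0; first by rewrite !qform0 mulr0.
pose E := [set v : R | forall x, qform S1 x <= v * qform S2 x].
have lbE x v : x != 0 -> E v -> qform S1 x / qform S2 x <= v.
  by move=> xn Ev; rewrite ler_pdivrMr ?p2.
have E0 : E !=set0.
  have [e [e0 He]] := psd_unit_coercive s2 (posdef_semi p2) (posdef_unit p2).
  exists (`|S1| * (2 * p%:R) / e) => x.
  rewrite (le_trans (ler_norm _))// (le_trans (qform_le _ _))//.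
  rewrite -[leRHS]mulrA ler_wpM2l ?mulr_ge0//.
  by rewrite ler_pdivlMl.
pose v := inf E.
have Ev : E v.
  move=> x; have [->|xn] := eqVneq x 0; first by rewrite !qform0 mulr0.
  rewrite -ler_pdivrMr ?p2//; apply: lb_le_inf => // w Ew; exact: lbE.
pose S := v *: S2 - S1.
have SE x : qform S x = v * qform S2 x - qform S1 x.
  by rewrite qformD qformN qformZ.
have sS : sym S by rewrite /sym trmxB linearZ/= s1 s2.
have S0 : possemidef S by move=> x; rewrite SE subr_ge0; exact: Ev.
have [uS|] := boolP (S \in unitmx).
  have [e [e0 He]] := psd_unit_coercive sS S0 uS.
  pose c := `|S2| * (2 * p%:R) + 1.
  have c0 : 0 < c by rewrite ltr_wpDl// !mulr_ge0.
  have q2 x : qform S2 x <= c * dot x x.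
    rewrite (le_trans (ler_norm _))// (le_trans (qform_le _ _))//.
    by rewrite ler_wpM2r ?dot_ge0// /c lerDl.
  have : E (v - e / c).
    move=> x; have := He x; rewrite SE => Hx.
    suff : e / c * qform S2 x <= e * dot x x by lra.
    by rewrite -[leLHS]mulrA ler_pM2l// ler_pdivrMl.
  have hlb : has_lbound E by exists (qform S1 x0 / qform S2 x0) => w; exact: lbE.
  move=> /(ge_inf hlb); rewrite -/v.
  by rewrite lerBrDl gerDr leNgt divr_gt0.
move=> nuS; suff vmu : v <= mu.
  by apply: le_trans (Ev x0) _; rewrite ler_wpM2r// posdef_semi.
have [x [xn Sx]] : exists x : 'cV_p, x != 0 /\ S *m x = 0.
  apply: contrapT => /forallNP nx; move/negP : nuS; apply; apply: unitmx_ker0 => x Sx.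
  by apply: contrapT => /eqP xn; exact: (nx x).
apply: (H _ x xn); apply/esym/eqP; rewrite -subr_eq0.
by move/eqP : Sx; rewrite /S mulmxBl -scalemxAl.
Qed.

End Pencil.

(** * Observability *)

Section Flat.
Variable R : realType.

Definition flat p q (F : R -> 'M[R]_(p, q)) (t : R) :=
  forall k, derive1n k F t = 0.

Lemma flat_derive1 p q (F : R -> 'M[R]_(p, q)) t :
  flat F t -> flat (derive1 F) t.
Proof. by move=> H k; rewrite -derive1Sn; exact: H. Qed.

Lemma derive1_eq p q (F dF : R -> 'M[R]_(p, q)) :
  (forall t : R, is_derive t 1 F (dF t)) -> derive1 F = dF.
Proof. by move=> H; apply/funext => t; rewrite derive1E; have [] := H t. Qed.

Lemma derive1nD p q k (F G : R -> 'M[R]_(p, q)) : smooth F -> smooth G ->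
  derive1n k (fun t => F t + G t) = (fun t => derive1n k F t + derive1n k G t).
Proof.
elim: k F G => [//|k IH] F G sF sG; rewrite !derive1Sn.
have -> : derive1 (fun t => F t + G t) = (fun t => derive1 F t + derive1 G t).
  apply: derive1_eq => t.
  exact: (is_deriveD (smooth_is_derive t sF) (smooth_is_derive t sG)).
exact: (IH _ _ (smooth_derive1 sF) (smooth_derive1 sG)).
Qed.

Lemma flatD p q (F G : R -> 'M[R]_(p, q)) t : smooth F -> smooth G ->
  flat F t -> flat G t -> flat (fun t => F t + G t) t.
Proof. by move=> sF sG fF fG k; rewrite derive1nD// fF fG addr0. Qed.

(** Leibniz rule; the induction on the order is over both factors at once, since differentiation
    replaces either one by its derivative. *)
Lemma flat_mulmxl p q r (L : R -> 'M[R]_(p, q)) (F : R -> 'M[R]_(q, r)) t :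
  smooth L -> smooth F -> flat F t -> flat (fun t => L t *m F t) t.
Proof.
move=> sL sF fF k; elim: k L F sL sF fF => [|k IH] L F sL sF fF.
  by have := fF 0%N; rewrite !derive1n0 => ->; rewrite mulmx0.
rewrite derive1Sn.
have -> : derive1 (fun t => L t *m F t) =
    (fun t => derive1 L t *m F t + L t *m derive1 F t).
  apply: derive1_eq => s.
  exact: (is_derive_mulmx (smooth_is_derive s sL) (smooth_is_derive s sF)).
have sL' := smooth_derive1 sL; have sF' := smooth_derive1 sF.
rewrite derive1nD; [|exact: smooth_mulmx|exact: smooth_mulmx].
rewrite (IH _ _ sL' sF fF) (IH _ _ sL sF' (flat_derive1 fF)).
by rewrite addr0.
Qed.

Lemma flat_eq0_itv p q (F : R -> 'M[R]_(p, q)) (a b : R) :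
  (forall r, a < r < b -> F r = 0) -> forall r, a < r < b -> flat F r.
Proof.
move=> F0 r rab k; elim: k F F0 r rab => [|k IH] F F0 r rab; first exact: F0.
rewrite derive1Sn; apply: IH rab => s /andP[as_ sb]; rewrite derive1E.
rewrite (@near_eq_derive _ _ _ _ (cst 0)) ?derive_cst//.
near=> x; apply: F0; apply/andP; split; near: x.
  exact: lt_nbhsr.
exact: lt_nbhsl.
Unshelve. all: by end_near. Qed.

Lemma continuous_eq0 p q (F : R -> 'M[R]_(p, q)) (t : R) : continuous F ->
  (forall d : R, 0 < d -> exists r, `|t - r| < d /\ F r = 0) -> F t = 0.
Proof.
move=> cF H; apply/eqP; apply: contraT => Ft0.
have e0 : 0 < `|F t| by rewrite normr_gt0.
have /cvgrPdist_lt/(_ _ e0)/nbhs_ballP[d /= d0 Hd] := cF t.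
have [r [rd Fr]] := H d d0; have := Hd r rd.
by rewrite Fr subr0 ltxx.
Qed.

Lemma flat_limit p q (F : R -> 'M[R]_(p, q)) (t : R) : smooth F ->
  (forall d : R, 0 < d -> exists r, `|t - r| < d /\ flat F r) -> flat F t.
Proof.
move=> sF H k; apply: continuous_eq0 => [s|d /H[r [rd fr]]].
  exact: is_derive_continuous (derivableP (sF k s)).
by exists r.
Qed.

End Flat.

Section Observability.
Variables (R : realType) (n m : nat).
Variables (A : R -> 'M[R]_n) (B : R -> 'M[R]_(n, m)).
Hypotheses (sA : smooth A) (sB : smooth B) (hspan : span_condition A B).

Lemma smooth_Bseq k : smooth (Defs.Bseq A B k).
Proof.
elim: k => [//|k IH]; apply: smoothB; first exact: smooth_derive1.
exact: smooth_mulmx.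
Qed.

(* The outputs [h_k = B_k^T q] satisfy [h_k' = h_{k+1} + B_k^T K^T h_0], so that
   they are all flat as soon as [h_0] is. *)
Lemma flat_output_eq0 p (K : R -> 'M[R]_(m, n)) (q : R -> 'M[R]_(n, p)) (t : R) :
  smooth K -> smooth q ->
  (forall r : R, is_derive r 1 q (- ((A r - B r *m K r)^T *m q r))) ->
  flat (fun r => (B r)^T *m q r) t -> q t = 0.
Proof.
move=> sK sq Hq f0.
have sBT := smooth_trmx sB.
have sh k : smooth (fun r => (Defs.Bseq A B k r)^T *m q r).
  exact: (smooth_mulmx (smooth_trmx (@smooth_Bseq k)) sq).
have fh k : flat (fun r => (Defs.Bseq A B k r)^T *m q r) t.
  elim: k => [//|k IH].
  have E : (fun r => (Defs.Bseq A B k.+1 r)^T *m q r) = (fun r =>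
      derive1 (fun r => (Defs.Bseq A B k r)^T *m q r) r +
      (- ((Defs.Bseq A B k r)^T *m (K r)^T)) *m ((B r)^T *m q r)).
    have -> : derive1 (fun r => (Defs.Bseq A B k r)^T *m q r) = (fun r =>
        (derive1 (Defs.Bseq A B k) r)^T *m q r +
        (Defs.Bseq A B k r)^T *m (- ((A r - B r *m K r)^T *m q r))).
      apply: derive1_eq => r; apply: is_derive_mulmx (Hq r).
      exact: is_derive_trmx (smooth_is_derive r (@smooth_Bseq k)).
    apply/funext => r /=; rewrite !trmxB !trmx_mul.
    rewrite !(mulmxDl, mulmxDr, mulmxN, mulNmx) !mulmxA.
    by apply/matrixP => i j; rewrite !(mxDE, mxNE); ring.
  have sL : smooth (fun r => - ((Defs.Bseq A B k r)^T *m (K r)^T)).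
    exact: (smoothN (smooth_mulmx (smooth_trmx (@smooth_Bseq k)) (smooth_trmx sK))).
  rewrite E; apply: flatD.
  - exact: smooth_derive1 (sh k).
  - exact: smooth_mulmx sL (sh 0%N).
  - exact: flat_derive1 IH.
  - exact: flat_mulmxl sL (sh 0%N) f0.
apply/row_matrixP => i; rewrite row0 rowE.
(* Each basis vector is a combination of vectors [B_j(t) w], and [w^T B_j(t)^T q(t) = 0] is flatness
   at order 0. *)
have : ((delta_mx 0 i : 'rV[R]_n)^T) \in (setT : set 'cV[R]_n) by rewrite inE.
rewrite -(hspan t) inE => -[N [a [v [Hv Ev]]]].
rewrite -[delta_mx _ _]trmxK Ev raddf_sum/= mulmx_suml big1// => k _.
have [w [j ->]] := Hv k.
have := fh j 0%N; rewrite derive1n0 => H0.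
by rewrite linearZ/= -scalemxAl trmx_mul -mulmxA H0 mulmx0 scaler0.
Qed.

End Observability.

(** If [B^T B x = 0] then [|B x|^2 = 0]. *)
Lemma injective_gram_unit (R : realType) n m (B : R -> 'M[R]_(n, m)) t :
  injective_input B -> (B t)^T *m B t \in unitmx.
Proof.
move=> hinj; apply: unitmx_ker0 => x BBx; apply: (hinj t); rewrite mulmx0.
by apply: dot_eq0; rewrite dot_mulmx mulmxA BBx dot0r.
Qed.

(** * Pairs of closed loops *)

Section Pair.
Variables (R : realType) (n m : nat).
Variables (A : R -> 'M[R]_n) (B : R -> 'M[R]_(n, m)) (K : R -> 'M[R]_(m, n)).
Variables (Ap Am : R -> 'M[R]_n) (Phip Phim : R -> R -> 'M[R]_n).
Hypotheses (sA : smooth A) (sB : smooth B) (sK : smooth K).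
Hypotheses (sAp : smooth Ap) (sAm : smooth Am).
Hypotheses (hPhip : is_transition Ap Phip) (hPhim : is_transition Am Phim).
Hypotheses (hspan : span_condition A B) (hinj : injective_input B).
Hypothesis (ApE : forall t, Ap t = A t - B t *m K t).

Let cp : continuous Ap. Proof. exact: smooth_continuous sAp. Qed.
Let cm : continuous Am. Proof. exact: smooth_continuous sAm. Qed.

(* The equations satisfied by [V = - (P_- - P_+)^-1] when [Z = R^-1]. *)
Definition coupled (V : R -> 'M[R]_n) (Z : R -> 'M[R]_m) :=
  forall t : R, [/\ sym (V t),
    is_derive t 1 V (Am t *m V t + V t *m (Ap t)^T) &
    (Am t - Ap t) *m V t = B t *m Z t *m (B t)^T].

Lemma coupled_transport V Z t : coupled V Z ->
  V t = Phim t 0 *m V 0 *m (Phip t 0)^T.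
Proof.
move=> H.
suff E : Phim 0 t *m V t *m (Phip 0 t)^T = Phim 0 0 *m V 0 *m (Phip 0 0)^T.
  move: E; rewrite (transition_id hPhim) (transition_id hPhip) trmx1 mulmx1.
  rewrite mul1mx => <-; rewrite !mulmxA (transition_inv cm hPhim) mul1mx.
  by rewrite -mulmxA -trmx_mul (transition_inv cp hPhip) trmx1 mulmx1.
apply: (@derive0_cst _ _ _ (fun r => Phim 0 r *m V r *m (Phip 0 r)^T)).
move=> r; have [_ dV _] := H r.
have H1 := transition_derive_r cp hPhip 0 r.
have H2 := transition_derive_r cm hPhim 0 r.
apply: is_derive_eq (is_derive_mulmx (is_derive_mulmx H2 dV) (is_derive_trmx H1)) _.
rewrite trmxN trmx_mul !(mulmxDl, mulmxDr, mulNmx, mulmxN) !mulmxA.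
by apply/matrixP => i j; rewrite !(mxDE, mxNE) mx0E; ring.
Qed.

Lemma integrand_smooth Z t : smooth Z ->
  smooth (fun s => Phip t s *m B s *m Z s *m (B s)^T *m (Phip t s)^T).
Proof.
move=> sZ; have sP := @smooth_transition_r _ _ _ _ cp hPhip t sAp.
exact: (smooth_mulmx (smooth_mulmx (smooth_mulmx (smooth_mulmx sP sB) sZ)
  (smooth_trmx sB)) (smooth_trmx sP)).
Qed.

(** The integrand is the derivative of [F(s) = Phi_+(t,s) V(s) Phi_+(t,s)^T], because
    [V' - A_+ V - V A_+^T = (A_- - A_+) V]. By transport and symmetry of [V],
    [F(0) = V(t) Phi_-(t,0)^-T Phi_+(t,0)^T]. *)
Lemma coupled_equation V Z : smooth Z -> coupled V Z -> forall t,
  (Am t - Ap t) *m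
    mxint 0 t (fun s => Phip t s *m B s *m Z s *m (B s)^T *m (Phip t s)^T)
  - B t *m Z t *m (B t)^T
    *m (1%:M - (invmx (Phim t 0))^T *m (Phip t 0)^T) = 0.
Proof.
move=> sZ H t; pose F s := Phip t s *m V s *m (Phip t s)^T.
have HF (s : R) : is_derive s 1 F
    (Phip t s *m B s *m Z s *m (B s)^T *m (Phip t s)^T).
  have [_ dV E] := H s; have H1 := transition_derive_r cp hPhip t s.
  apply: is_derive_eq (is_derive_mulmx (is_derive_mulmx H1 dV) (is_derive_trmx H1)) _.
  have -> : Phip t s *m B s *m Z s *m (B s)^T *m (Phip t s)^T =
      Phip t s *m (B s *m Z s *m (B s)^T) *m (Phip t s)^T by rewrite !mulmxA.
  rewrite -E trmxN trmx_mul !(mulmxDl, mulmxDr, mulNmx, mulmxN) !mulmxA.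
  by apply/matrixP => i j; rewrite !(mxDE, mxNE); ring.
rewrite (mxint_FTC 0 t HF (smooth_continuous (@integrand_smooth Z t sZ))) /F.
rewrite (transition_id hPhip) trmx1 mulmx1 mul1mx (invmx_transition cm hPhim).
have -> : Phip t 0 *m V 0 *m (Phip t 0)^T =
    V t *m ((Phim 0 t)^T *m (Phip t 0)^T).
  have [sV _ _] := H t; have [sV0 _ _] := H 0.
  rewrite -{1}sV (coupled_transport t H) !trmx_mul trmxK sV0 !mulmxA.
  rewrite -(mulmxA _ (Phim t 0)^T) -trmx_mul (transition_inv cm hPhim).
  by rewrite trmx1 mulmx1.
have [_ _ <-] := H t.
by rewrite !mulmxBr mulmx1 !mulmxA subrr.
Qed.

(** [Phi_+(0,r)^T w] solves the adjoint equation of the closed loop [A - B K], to which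
    observability applies. *)
Lemma outputs_eq0 p (w : 'M[R]_(n, p)) (t : R) :
  flat (fun r => (B r)^T *m ((Phip 0 r)^T *m w)) t -> w = 0.
Proof.
move=> H; have sP := @smooth_transition_r _ _ _ _ cp hPhip 0 sAp.
have := @flat_output_eq0 _ _ _ A B sA sB hspan _ K
  (fun r => (Phip 0 r)^T *m w) t sK (smooth_mulmx (smooth_trmx sP) (@smooth_cst _ _ _ w)) _ H.
move=> /(_ _)/wrap[r|/(congr1 (mulmx (Phip t 0)^T))].
  have := is_derive_mulmxr w (is_derive_trmx (transition_derive_r cp hPhip 0 r)).
  by rewrite trmxN trmx_mul mulNmx -mulmxA ApE.
by rewrite mulmx0 mulmxA -trmx_mul (transition_inv cp hPhip) trmx1 mul1mx.
Qed.

(** The weight [B Z B^T] carried back to time 0 by the flow of [Ap], written [N] below, or [N_0] for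
    [Z0]. *)
Definition pullback (Z : R -> 'M[R]_m) (t : R) :=
  Phip 0 t *m B t *m Z t *m (B t)^T *m (Phip 0 t)^T.

Lemma qform_pullback Z t w : qform (pullback Z t) w =
  qform (Z t) ((B t)^T *m ((Phip 0 t)^T *m w)).
Proof.
by rewrite /pullback !qformE -!mulmxA !dot_mulmx !trmxK.
Qed.

Lemma sym_pullback Z t : sym (Z t) -> sym (pullback Z t).
Proof. by move=> sZ; rewrite /sym /pullback !trmx_mul !trmxK sZ !mulmxA. Qed.

Lemma pullback_smooth Z : smooth Z -> smooth (pullback Z).
Proof. exact: integrand_smooth. Qed.

(** Definiteness of [Z] makes the output of [w] vanish on the interval, so it is flat at the
    midpoint. *)
Lemma pullback_eq0 Z (w : 'cV[R]_n) (a b : R) : a < b ->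
  (forall t, posdef (Z t)) ->
  (forall t, a < t < b -> qform (pullback Z t) w = 0) -> w = 0.
Proof.
move=> ab pZ H; have mab : a < (a + b) / 2 < b.
  by rewrite midf_lt// midf_lt.
apply: (@outputs_eq0 _ w ((a + b) / 2)).
apply: (@flat_eq0_itv _ _ _ _ a b _ _ mab) => t /H.
rewrite qform_pullback => Hq; apply/eqP; apply: contraT => /(pZ t).
by rewrite Hq ltxx.
Qed.

(** A nondecreasing function with equal end values is constant in between, so its derivative
    vanishes there. *)
Lemma pullback_primitive_eq0 Z (w : 'cV[R]_n) (f : R -> R) (a b : R) : a < b ->
  (forall t, posdef (Z t)) ->
  (forall t : R, is_derive t 1 f (qform (pullback Z t) w)) -> f a = f b ->
  w = 0.
Proof.
move=> ab pZ Hf fab; apply: (pullback_eq0 ab pZ) => t /andP[at_ tb].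
have mono x y : x <= y -> f x <= f y.
  move=> xy; apply: (ler_of_derive xy (fun t _ => Hf t)) => s _.
  by rewrite qform_pullback; exact: posdef_semi.
have [_ <-] := Hf t.
rewrite (@near_eq_derive _ _ _ _ (cst (f a))) ?derive_cst//.
near=> x; have ax : a <= x by apply: ltW; near: x; exact: lt_nbhsr.
have xb : x <= b by apply: ltW; near: x; exact: lt_nbhsl.
by apply/eqP; rewrite eq_le (mono _ _ ax) fab (mono _ _ xb).
Unshelve. all: by end_near. Qed.

Definition flow_ratio t := Phip 0 t *m Phim t 0.
Local Notation T := flow_ratio.

(** The logarithmic derivative of [T]: [T' = M T], with [T(0) = 1]. *)
Definition gap_pullback t := Phip 0 t *m (Am t - Ap t) *m Phip t 0.
Local Notation M := gap_pullback.

Let T0 : T 0 = 1%:M.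
Proof. by rewrite /flow_ratio (transition_id hPhip) (transition_id hPhim) mulmx1. Qed.

Let T_derive t : is_derive t (1 : R) T (M t *m T t).
Proof.
apply: is_derive_eq (is_derive_mulmx (transition_derive_r cp hPhip 0 t)
  (transition_derive hPhim 0 t)) _.
rewrite /gap_pullback /flow_ratio !mulmxA -(mulmxA _ (Phip t 0)).
rewrite (transition_inv cp hPhip) mulmx1.
by rewrite mulmxBr mulmxBl mulNmx addrC.
Qed.

Let T_smooth : smooth T.
Proof.
exact: (smooth_mulmx (@smooth_transition_r _ _ _ _ cp hPhip 0 sAp)
  (@smooth_transition _ _ _ _ hPhim 0 sAm)).
Qed.

Let T_unit t : T t \in unitmx.
Proof.
by rewrite unitmx_mul (transition_unit cp hPhip) (transition_unit cm hPhim).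
Qed.

(** The algebraic relation of [coupled], carried to time 0. The left side is [T' V(0)], so
    [(T - 1) V(0)] is a primitive of [pullback Z]. *)
Let coupledT V Z t : coupled V Z -> M t *m T t *m V 0 = pullback Z t.
Proof.
move=> H; have [_ _ E] := H t.
have -> : pullback Z t = Phip 0 t *m (B t *m Z t *m (B t)^T) *m (Phip 0 t)^T.
  by rewrite /pullback !mulmxA.
rewrite -E (coupled_transport t H) -!mulmxA -trmx_mul (transition_inv cp hPhip).
rewrite trmx1 mulmx1 (mulmxA (Phip t 0) (Phip 0 t)).
by rewrite (transition_inv cp hPhip) mul1mx.
Qed.

(** If [T(t) x = x] and [w = V(0)^-1 x], then [w^T T(r) x] has derivative [w^T N(r) w >= 0] and
    equal values at [0] and [t], which forces [w = 0]. *)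
Let T_sub1_unit V Z t : coupled V Z -> V 0 \in unitmx ->
  (forall t, posdef (Z t)) -> t != 0 -> T t - 1%:M \in unitmx.
Proof.
move=> H uV pZ t0; apply: unitmx_ker0 => x Tx.
pose w := invmx (V 0) *m x; have Vw : V 0 *m w = x by rewrite mulKVmx.
suff w0 : w = 0 by rewrite -Vw w0 mulmx0.
pose f r := dot w (T r *m x).
have Hf (r : R) : is_derive r 1 f (qform (pullback Z r) w).
  have := is_derive_dot (is_derive_cst w r (1 : R)) (is_derive_mulmxr x (T_derive r)).
  have -> : M r *m T r *m x = pullback Z r *m w.
    by rewrite -(coupledT r H) -[in RHS]mulmxA Vw.
  by rewrite dot0l add0r -qformE.
have f0t : f 0 = f t.
  rewrite /f T0; congr dot; apply/esym/eqP.
  by rewrite -subr_eq0 -mulmxBl Tx.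
have [t_gt0|t_lt0|/eqP] := ltgtP 0 t; last by rewrite eq_sym (negbTE t0).
  exact: (pullback_primitive_eq0 t_gt0 pZ Hf).
exact: (pullback_primitive_eq0 t_lt0 pZ Hf).
Qed.

(** * From the integral equation back to a coupled solution *)

Section Converse.
Variables (V : R -> 'M[R]_n) (Z0 Z : R -> 'M[R]_m).
Hypotheses (hV : coupled V Z0) (uV : V 0 \in unitmx).
Hypotheses (sZ0 : smooth Z0) (sZ : smooth Z).
Hypotheses (pZ0 : forall t, sym (Z0 t) /\ posdef (Z0 t)).
Hypotheses (pZ : forall t, sym (Z t) /\ posdef (Z t)).
Hypothesis hZ : forall t,
  (Am t - Ap t) *m
    mxint 0 t (fun s => Phip t s *m B s *m Z s *m (B s)^T *m (Phip t s)^T)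
  - B t *m Z t *m (B t)^T
    *m (1%:M - (invmx (Phim t 0))^T *m (Phip t 0)^T) = 0.

Definition pullback_primitive t := mxint 0 t (pullback Z).
Local Notation X := pullback_primitive.

Let X_derive (t : R) : is_derive t 1 X (pullback Z t).
Proof.
exact: (mxint_derive 0 t (smooth_continuous (pullback_smooth sZ))).
Qed.

Let X0 : X 0 = 0. Proof. exact: mxint_id. Qed.

Let symX t : sym (X t).
Proof.
apply: (@eq_of_derive _ _ _ (fun t => (X t)^T) X (pullback Z) 0) => //.
- move=> r; apply: is_derive_eq (is_derive_trmx (X_derive r)) _.
  by apply: sym_pullback; have [] := pZ r.
- by rewrite X0 trmx0.
Qed.

(** This is [hZ] carried to time 0 and multiplied on the right by [T^T]; the cocycle rule turns the
    integral into [Phi_+(t,0) X Phi_+(t,0)^T]. *)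
Let equationX t : pullback Z t *m ((T t)^T - 1%:M) = M t *m X t *m (T t)^T.
Proof.
have HF (s : R) : is_derive s 1 (fun s => Phip t 0 *m X s *m (Phip t 0)^T)
    (Phip t s *m B s *m Z s *m (B s)^T *m (Phip t s)^T).
  apply: is_derive_eq (is_derive_mulmxr _ (is_derive_mulmxl _ (X_derive s))) _.
  by rewrite -(transition_cocycle cp hPhip t 0 s) trmx_mul /pullback !mulmxA.
have := hZ t.
rewrite (mxint_FTC 0 t HF (smooth_continuous (@integrand_smooth Z t sZ))).
rewrite X0 mulmx0 mul0mx subr0 (invmx_transition cm hPhim) => /eqP.
rewrite subr_eq0 => /eqP E.
have := congr1 (fun L => Phip 0 t *m L *m (Phip 0 t)^T *m (T t)^T) E.
have PP : (Phip t 0)^T *m (Phip 0 t)^T = 1%:M.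
  by rewrite -trmx_mul (transition_inv cp hPhip) trmx1.
rewrite /= !mulmxA -(mulmxA _ (Phip t 0)^T) PP mulmx1 => {E}.
rewrite -/(M t) => ->; rewrite /pullback -!mulmxA; do 4 congr (_ *m _).
have MM : (Phim 0 t)^T *m (Phim t 0)^T = 1%:M.
  by rewrite -trmx_mul (transition_inv cm hPhim) trmx1.
rewrite mulmxBr mulmx1 mulmxBl mul1mx; congr (_ - _).
by rewrite -mulmxA (mulmxA (Phip t 0)^T) PP mul1mx /flow_ratio trmx_mul mulmxA MM mul1mx.
Qed.

(** With [J = T^-1], the equation gives [(J X)' = J N J^T], which is symmetric; so [J X] is
    symmetric, and multiplying by [T] and [T^T] concludes. *)
Let symTX t : X t *m (T t)^T = T t *m X t.
Proof.
pose J r := invmx (T r).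
have HJ (r : R) : is_derive r 1 J (- (J r *m M r)).
  apply: is_derive_eq (is_derive_invmx T_unit (T_derive r)) _.
  by rewrite (mulmxA (invmx _)) mulmxK.
have MX r : M r *m X r = pullback Z r - pullback Z r *m (J r)^T.
  have : pullback Z r *m (((T r)^T - 1%:M) *m (J r)^T) =
      M r *m X r *m ((T r)^T *m (J r)^T) by rewrite !mulmxA equationX.
  by rewrite mulmxBl mul1mx -trmx_mul mulVmx// trmx1 mulmx1 mulmxBr mulmx1 => <-.
have HJX (r : R) : is_derive r 1 (fun r => J r *m X r)
    (J r *m pullback Z r *m (J r)^T).
  apply: is_derive_eq (is_derive_mulmx (HJ r) (X_derive r)) _.
  rewrite mulNmx -(mulmxA (J r) (M r) (X r)) MX mulmxBr opprB -addrA.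
  by rewrite addNr addr0 mulmxA.
have E : (J t *m X t)^T = J t *m X t.
  apply: (@eq_of_derive _ _ _ (fun t => (J t *m X t)^T) (fun t => J t *m X t) _ 0).
  - by move=> r; exact: is_derive_trmx (HJX r).
  - move=> r; apply: is_derive_eq (HJX r) _.
    have sN : sym (pullback Z r) by apply: sym_pullback; have [] := pZ r.
    by rewrite trmx_mul trmxK trmx_mul sN mulmxA.
  - by rewrite X0 mulmx0 trmx0.
move: E; rewrite trmx_mul symX => E.
have := congr1 (fun L => T t *m L *m (T t)^T) E.
rewrite /= !mulmxA mulmxV// mul1mx -(mulmxA _ _ (T t)^T) -trmx_mul.
by rewrite mulmxV// trmx1 mulmx1 => ->.
Qed.

(** Forced by [X = (T - 1) W(0)], which every coupled [W] with weight [Z] satisfies; it carries no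
    information at [t = 0], where [T - 1] vanishes. *)
Definition initial_value t := invmx (T t - 1%:M) *m X t.
Local Notation C := initial_value.

Let BB_unit t := injective_gram_unit t hinj.

Let T1 t : t != 0 -> T t - 1%:M \in unitmx.
Proof. by apply: (T_sub1_unit hV uV) => r; have [] := pZ0 r. Qed.

Let CX t : t != 0 -> C t = X t *m invmx ((T t)^T - 1%:M).
Proof.
move=> t0; have u := T1 t0; have uT : (T t)^T - 1%:M \in unitmx.
  by rewrite -unitmx_tr trmxB trmxK trmx1.
have E : X t *m ((T t)^T - 1%:M) = (T t - 1%:M) *m X t.
  by rewrite mulmxBr mulmx1 symTX mulmxBl mul1mx.
by rewrite /initial_value -[X t in LHS](mulmxK uT) E !mulmxA mulVmx// mul1mx.
Qed.

Let symC t : t != 0 -> sym (C t).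
Proof.
move=> t0; rewrite /sym CX// trmx_mul symX trmx_inv trmxB trmxK trmx1.
by rewrite -CX.
Qed.

(** Here [C' = (T - 1)^-1 (N - M T C)], and [N = M T C] follows from [equationX] and [symTX] with
    the form of [C] in [CX]. *)
Let C_derive (t : R) : t != 0 -> is_derive t 1 C 0.
Proof.
move=> t0; have u := T1 t0; have uT : (T t)^T - 1%:M \in unitmx.
  by rewrite -unitmx_tr trmxB trmxK trmx1.
have nu : \forall x \near t, T x - 1%:M \in unitmx.
  have [tp|tn|te] := ltgtP 0 t; last by rewrite -te eqxx in t0.
    by near=> x; apply: T1; rewrite gt_eqF//; near: x; exact: lt_nbhsr.
  by near=> x; apply: T1; rewrite lt_eqF//; near: x; exact: lt_nbhsl.
have dT : is_derive t (1 : R) (fun t => T t - 1%:M) (M t *m T t).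
  by have := is_deriveB (T_derive t) (is_derive_cst 1%:M t (1 : R)); rewrite subr0.
apply: is_derive_eq (is_derive_mulmx (is_derive_invmx_near nu dT) (X_derive t)) _.
rewrite mulNmx -!mulmxA -/(C t) CX// addrC -mulmxBr.
rewrite -[pullback Z t](mulmxK uT) equationX -(mulmxA (M t)) symTX.
by rewrite -!mulmxA subrr mulmx0.
Unshelve. all: by end_near. Qed.

Let CX_pos t : 0 < t -> X t = (T t - 1%:M) *m C 1.
Proof.
move=> t0; have -> : C 1 = C t.
  have [t1|/ltW t1] := leP t 1; last first.
    apply: (eq_of_derive0 t1) => x /andP[x1 _].
    by apply: C_derive; rewrite gt_eqF// (lt_le_trans _ x1).
  apply/esym/(eq_of_derive0 t1) => x /andP[x1 _].
  by apply: C_derive; rewrite gt_eqF// (lt_le_trans _ x1).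
by rewrite /initial_value mulKVmx// T1// gt_eqF.
Qed.

Let CX_neg t : t < 0 -> X t = (T t - 1%:M) *m C (-1).
Proof.
move=> t0; have -> : C (-1) = C t.
  have [t1|/ltW t1] := leP t (-1); last first.
    apply: (eq_of_derive0 t1) => x /andP[_ x1].
    by apply: C_derive; rewrite lt_eqF// (le_lt_trans x1).
  apply/esym/(eq_of_derive0 t1) => x /andP[_ x1].
  by apply: C_derive; rewrite lt_eqF// (le_lt_trans x1)// ltrN10.
by rewrite /initial_value mulKVmx// T1// lt_eqF.
Qed.

Let X_smooth : smooth X.
Proof. exact: (smooth_primitive X_derive (pullback_smooth sZ)). Qed.

Let flat_residual_smooth (D : 'M[R]_n) : smooth (fun t => X t - (T t - 1%:M) *m D).
Proof.
exact: (smoothB X_smooth (smooth_mulmx (smoothB T_smooth (@smooth_cst _ _ _ 1%:M))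
  (@smooth_cst _ _ _ D))).
Qed.

(** The residual vanishes for positive times, and flatness passes to the limit time 0 because every
    derivative is continuous. *)
Let flat_pos : flat (fun t => X t - (T t - 1%:M) *m C 1) 0.
Proof.
apply: flat_limit => [|d d0]; first exact: flat_residual_smooth.
exists (d / 2); split; first by rewrite sub0r normrN gtr0_norm; lra.
apply: (@flat_eq0_itv _ _ _ _ 0 d) => [r /andP[r0 _]|].
  by rewrite CX_pos// subrr.
by apply/andP; split; lra.
Qed.

Let flat_neg : flat (fun t => X t - (T t - 1%:M) *m C (-1)) 0.
Proof.
apply: flat_limit => [|d d0]; first exact: flat_residual_smooth.
exists (- (d / 2)); split; first by rewrite sub0r opprK gtr0_norm; lra.
apply: (@flat_eq0_itv _ _ _ _ (- d) 0) => [r /andP[_ r0]|].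
  by rewrite CX_neg// subrr.
by apply/andP; split; lra.
Qed.

(* [(T - 1) E] is flat at [0], hence so is its derivative [M T E = N_0 w], from
   which the injectivity of [B] recovers [B^T Phi^T w]. *)
Let C_glue : C 1 = C (-1).
Proof.
pose E := C 1 - C (-1); pose w := invmx (V 0) *m E.
have fTE : flat (fun t => (T t - 1%:M) *m E) 0.
  have fN : flat (fun t => (- 1%:M) *m (X t - (T t - 1%:M) *m C 1)) 0.
    apply: flat_mulmxl; [exact: (@smooth_cst _ _ _ (- 1%:M))|
      exact: flat_residual_smooth|exact: flat_pos].
  have := flatD (@flat_residual_smooth (C (-1)))
    (smooth_mulmx (@smooth_cst _ _ _ (- 1%:M)) (@flat_residual_smooth (C 1)))
    flat_neg fN.
  congr (flat _ _); apply/funext => t; rewrite mulNmx mul1mx opprB /E mulmxBr.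
  by rewrite addrC addrA subrK.
have fN : flat (fun t => pullback Z0 t *m w) 0.
  have := flat_derive1 fTE; congr (flat _ _); apply: derive1_eq => t.
  have dT : is_derive t (1 : R) (fun t => T t - 1%:M) (M t *m T t).
    by have := is_deriveB (T_derive t) (is_derive_cst 1%:M t (1 : R)); rewrite subr0.
  apply: is_derive_eq (is_derive_mulmxr E dT) _.
  by rewrite /w -(coupledT t hV) -[in RHS]mulmxA mulKVmx.
have uZ0 t : Z0 t \in unitmx by apply: posdef_unit; have [] := pZ0 t.
(* [L] is a left inverse of the factor [Phi_+(0,t) B Z0] of [N_0]. *)
pose L t := invmx (Z0 t) *m invmx ((B t)^T *m B t) *m (B t)^T *m Phip t 0.
have sL : smooth L.
  have sI := smooth_invmx BB_unit (smooth_mulmx (smooth_trmx sB) sB).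
  exact: (smooth_mulmx (smooth_mulmx (smooth_mulmx (smooth_invmx uZ0 sZ0) sI)
    (smooth_trmx sB)) (@smooth_transition _ _ _ _ hPhip 0 sAp)).
have w0 : w = 0.
  apply: (@outputs_eq0 _ w 0).
  have := flat_mulmxl sL (smooth_mulmx (pullback_smooth sZ0) (@smooth_cst _ _ _ w)) fN.
  congr (flat _ _); apply/funext => t; rewrite /L /pullback -!mulmxA.
  rewrite (mulmxA (Phip t 0)) (transition_inv cp hPhip) mul1mx.
  by rewrite (mulmxA (B t)^T (B t)) mulKmx// mulKmx.
apply/eqP; rewrite -subr_eq0 -/E -[E](mulKVmx uV) -/w w0 mulmx0.
by rewrite eqxx.
Qed.

Let XC t : X t = (T t - 1%:M) *m C 1.
Proof.
have [t0|t0|->] := ltgtP t 0; last by rewrite T0 subrr mul0mx X0.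
  by rewrite (CX_neg t0) C_glue.
exact: CX_pos.
Qed.

Let NC t : pullback Z t = M t *m T t *m C 1.
Proof.
have dT : is_derive t (1 : R) (fun t => T t - 1%:M) (M t *m T t).
  by have := is_deriveB (T_derive t) (is_derive_cst 1%:M t (1 : R)); rewrite subr0.
have [_ <-] := X_derive t; have [_ <-] := is_derive_mulmxr (C 1) dT.
by congr ('D_1 _ t); apply/funext => r; exact: XC.
Qed.

(** Take [C_0 = C(1)]. Since [X = (T - 1) C_0], one has [W = Phi_+ (X + C_0) Phi_+^T], which is
    symmetric. The algebraic relation is [N = M T C_0] carried to time [t], and a kernel vector of
    [C_0] is annihilated by [N], hence is 0. *)
Lemma converse_coupled : exists C0 : 'M[R]_n, [/\ C0 \in unitmx, sym C0 &
  coupled (fun t => Phim t 0 *m C0 *m (Phip t 0)^T) Z].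
Proof.
have one0 : (1 : R) != 0 by rewrite oner_eq0.
exists (C 1); split; [|exact: symC|move=> t; split].
- apply: unitmx_ker0 => w Cw.
  apply: (@pullback_eq0 Z w 0 1 ltr01) => [t|t _]; first by have [] := pZ t.
  by rewrite NC qformE -(mulmxA _ (C 1)) Cw mulmx0 dot0r.
- have -> : Phim t 0 *m C 1 *m (Phip t 0)^T =
      Phip t 0 *m (X t + C 1) *m (Phip t 0)^T.
    by rewrite XC mulmxBl mul1mx subrK /flow_ratio !mulmxA (transition_inv cp hPhip) mul1mx.
  by rewrite /sym !trmx_mul trmxK trmxD symX symC// !mulmxA.
- apply: is_derive_eq (is_derive_mulmx (is_derive_mulmxr (C 1)
    (transition_derive hPhim 0 t)) (is_derive_trmx (transition_derive hPhip 0 t))) _.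
  by rewrite trmx_mul !mulmxA.
- have := congr1 (fun L => Phip t 0 *m L *m (Phip t 0)^T) (NC t).
  have PP : (Phip 0 t)^T *m (Phip t 0)^T = 1%:M.
    by rewrite -trmx_mul (transition_inv cp hPhip) trmx1.
  rewrite /pullback /gap_pullback /flow_ratio /= !mulmxA (transition_inv cp hPhip) !mul1mx.
  rewrite -(mulmxA _ (Phip 0 t)^T) PP mulmx1 => ->.
  by rewrite -(mulmxA _ (Phip t 0)) (transition_inv cp hPhip) mulmx1.
Qed.

End Converse.

(** The same flows transport [V] and [W], so [W = E V] with [E] conjugate to [W(0) V(0)^-1]. The
    transposed algebraic relations give [B Z B^T = E B Z0 B^T], and [B^T] cancels because [B^T B] is
    invertible. *)
Lemma coupled_conj V W Z0 Z t : coupled V Z0 -> coupled W Z ->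
  V 0 \in unitmx -> sym (Z0 t) -> sym (Z t) ->
  B t *m Z t = Phip t 0 *m (W 0 *m invmx (V 0)) *m Phip 0 t *m (B t *m Z0 t).
Proof.
move=> hV hW uV sZ0 sZ; have [sV _ EV] := hV t; have [sW _ EW] := hW t.
have [sV0 _ _] := hV 0; have [sW0 _ _] := hW 0.
set E := Phip t 0 *m _ *m Phip 0 t.
have W_V : W t = E *m V t.
  rewrite -sV -sW (coupled_transport t hV) (coupled_transport t hW).
  rewrite !trmx_mul !trmxK sV0 sW0 /E -!mulmxA (mulmxA (Phip 0 t)).
  by rewrite (transition_inv cp hPhip) mul1mx mulKmx.
have H Y X : sym (Y t) -> sym (X t) ->
    (Am t - Ap t) *m Y t = B t *m X t *m (B t)^T ->
    Y t *m (Am t - Ap t)^T = B t *m X t *m (B t)^T.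
  by move=> sY sX /(congr1 trmx); rewrite !trmx_mul trmxK sY sX mulmxA.
have uBB := injective_gram_unit t hinj.
rewrite -[LHS](mulmxK uBB) -[RHS](mulmxK uBB); congr (_ *m _).
rewrite [LHS]mulmxA [RHS]mulmxA -(H _ _ sW sZ EW) W_V.
by rewrite -(mulmxA E (B t *m Z0 t)) -(H _ _ sV sZ0 EV) !mulmxA.
Qed.

(** An eigenvector [x] of the pencil yields the eigenvector [Phi_+(0,t) B Z0 x] of the constant
    matrix [W(0) V(0)^-1], with the same eigenvalue; it is nonzero by injectivity of [B]. *)
Lemma coupled_eigenvalue_le V W Z0 Z : coupled V Z0 -> coupled W Z ->
  V 0 \in unitmx -> (forall t, sym (Z0 t) /\ posdef (Z0 t)) ->
  (forall t, sym (Z t) /\ posdef (Z t)) ->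
  forall t l (x : 'cV[R]_m), x != 0 -> Z t *m x = l *: (Z0 t *m x) ->
  l <= n%:R * `|W 0 *m invmx (V 0)|.
Proof.
move=> hV hW uV pZ0 pZ t l x x0 Zx.
have [sZ0 posZ0] := pZ0 t; have [sZ posZ] := pZ t.
set E := W 0 *m _; pose y := Phip 0 t *m (B t *m (Z0 t *m x)).
have y0 : y != 0.
  apply: contra x0 => /eqP Hy; apply/eqP.
  have : B t *m (Z0 t *m x) = B t *m 0.
    rewrite mulmx0 -[LHS]mul1mx -(transition_inv cp hPhip t 0) -mulmxA.
    by rewrite -/y Hy mulmx0.
  move=> /(hinj (t := t)) /(congr1 (mulmx (invmx (Z0 t)))).
  by rewrite mulKmx ?mulmx0// posdef_unit.
have Ey : E *m y = l *: y.
  have := coupled_conj hV hW uV sZ0 sZ.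
  move=> /(congr1 (fun L => Phip 0 t *m (L *m x))).
  rewrite /= -/E -!(mulmxA (Phip t 0)) -!mulmxA (mulmxA (Phip 0 t) (Phip t 0)).
  rewrite (transition_inv cp hPhip) mul1mx Zx -/y => <-.
  by rewrite -!scalemxAr.
have : `|l| * `|y| <= n%:R * `|E| * `|y|.
  by rewrite -mx_normZ -Ey norm_mulmx.
rewrite ler_pM2r ?normr_gt0//; apply: le_trans; exact: ler_norm.
Qed.

Lemma coupled_comparison V W Z0 Z : coupled V Z0 -> coupled W Z ->
  V 0 \in unitmx -> (forall t, sym (Z0 t) /\ posdef (Z0 t)) ->
  (forall t, sym (Z t) /\ posdef (Z t)) ->
  exists mu, 0 <= mu /\ forall t x,
    qform (invmx (Z0 t)) x <= mu * qform (invmx (Z t)) x.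
Proof.
move=> hV hW uV pZ0 pZ.
exists (n%:R * `|W 0 *m invmx (V 0)|); split; first by rewrite mulr_ge0.
move=> t; have [sZ0 posZ0] := pZ0 t; have [sZ posZ] := pZ t.
have [u0 u] := (posdef_unit posZ0, posdef_unit posZ).
apply: pencil_le; [exact: sym_invmx|exact: posdef_invmx|exact: sym_invmx|
  exact: posdef_invmx|].
(* In terms of [z = Z0^-1 x], the relation [Z0^-1 x = l Z^-1 x] reads [Z z = l Z0 z]. *)
move=> l x x0 Hx; pose z := invmx (Z0 t) *m x.
have xz : x = Z0 t *m z by rewrite mulKVmx.
apply: (coupled_eigenvalue_le hV hW uV pZ0 pZ (t := t) (x := z)).
  by apply: contra x0 => /eqP Hz; rewrite xz Hz mulmx0.
by rewrite -xz /z Hx -scalemxAr mulKVmx.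
Qed.

End Pair.

Lemma unif_posdef_posdef (R : realType) m (Rm : R -> 'M[R]_m) :
  unif_posdef Rm -> forall t, posdef (Rm t).
Proof.
move=> [a [a0 H]] t; apply: (posdef_ge a0) => x; exact: posdef_shift (H t).
Qed.

Lemma unif_posdef_invmx_bounded (R : realType) m (Rm : R -> 'M[R]_m) :
  unif_posdef Rm -> bounded_mx (fun t => invmx (Rm t)).
Proof.
move=> [a [a0 H]]; exists (1 + a ^- 2) => t; apply: norm_invmx_le => // x.
exact: posdef_shift (H t).
Qed.

Lemma dot_inj (R : realType) p q (M N : 'M[R]_(p, q)) :
  (forall x y, dot x (M *m y) = dot x (N *m y)) -> M = N.
Proof.
move=> H; apply/matrixP => i j; have := H (delta_mx i 0) (delta_mx j 0).
have d L : dot (delta_mx i 0) (L *m delta_mx j 0) = L i j.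
  rewrite dotE (bigD1 i)//= big1 => [|k ki]; rewrite -colE !mxE ?eqxx ?mul1r ?addr0//.
  by rewrite (negbTE ki) mul0r.
by rewrite !d.
Qed.

(** * Canonical costs *)

Section Feedback.
Variables (R : realType) (n m : nat).
Variables (A : R -> 'M[R]_n) (B : R -> 'M[R]_(n, m)).
Variables (K : R -> 'M[R]_(m, n)) (Rm : R -> 'M[R]_m).
Hypotheses (symR : forall t, sym (Rm t)) (pR : forall t, posdef (Rm t)).

Definition feedback_Q t := (K t)^T *m Rm t *m K t.
Definition feedback_S t := (K t)^T *m Rm t.

Lemma feedback_S_dot t x u :
  dot u (Rm t *m (K t *m x)) = dot x (feedback_S t *m u).
Proof.
by rewrite /feedback_S -mulmxA -dot_mulmx dotC -{1}(symR t) dot_mulmx trmxK.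
Qed.

Lemma mulmx_dot (S : 'M[R]_(n, m)) x u : (x^T *m S *m u) 0 0 = dot x (S *m u).
Proof. by rewrite /dot mulmxA. Qed.

Lemma feedback_quadratic t x u :
  feedback_cost K Rm t x u = quadratic_cost feedback_Q feedback_S Rm t x u.
Proof.
rewrite /feedback_cost /quadratic_cost (qform_add _ _ (symR t)) mulmx_dot.
by rewrite qform_mulmx -feedback_S_dot addrC addrA addrAC addrC; ring.
Qed.

(** Taking [x = 0] determines [R] and [u = 0] determines [Q]; what remains determines [S]. *)
Lemma feedback_quadratic_inj (Q : R -> 'M[R]_n) (S : R -> 'M[R]_(n, m))
    (Rm' : R -> 'M[R]_m) t : sym (Q t) -> sym (Rm' t) ->
  (forall x u, feedback_cost K Rm t x u = quadratic_cost Q S Rm' t x u) ->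
  [/\ Q t = feedback_Q t, S t = feedback_S t & Rm' t = Rm t].
Proof.
move=> sQ sR' H.
have ER : Rm' t = Rm t.
  apply: sym_qform_inj => // u; have := H 0 u.
  rewrite /feedback_cost /quadratic_cost mulmx0 addr0 qform0 mulmx_dot dot0l.
  by rewrite mulr0 !add0r.
have EQ : Q t = feedback_Q t.
  apply: sym_qform_inj => //.
    by rewrite /sym /feedback_Q !trmx_mul trmxK symR mulmxA.
  move=> x; have := H x 0; rewrite /feedback_cost /quadratic_cost add0r.
  by rewrite mulmx0 mxE mulr0 qform0 !addr0 /feedback_Q qform_mulmx.
split=> //; apply: dot_inj => x u; have := H x u.
rewrite feedback_quadratic /quadratic_cost ER EQ !mulmx_dot; lra.
Qed.

Let uR t : Rm t \in unitmx. Proof. exact: posdef_unit. Qed.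

Lemma feedback_closed_loop P t :
  closed_loop A B feedback_S Rm P t =
  A t - B t *m K t - B t *m invmx (Rm t) *m (B t)^T *m P t.
Proof.
rewrite /closed_loop /feedback_S trmx_mul trmxK symR mulmxDr.
rewrite -(mulmxA (B t)) (mulmxA (invmx _)) mulVmx// mul1mx.
by rewrite opprD addrA mulmxA.
Qed.

(** Since [Q = S R^-1 S^T] here, the terms free of [P] cancel in the Riccati equation; in particular
    [P = 0] is a solution. *)
Lemma feedback_riccati P : (forall t, sym (P t)) ->
  (forall t : R, is_derive t 1 P
    (- (P t *m closed_loop A B feedback_S Rm P t)
     - (A t - B t *m K t)^T *m P t)) ->
  riccati_solution A B feedback_Q feedback_S Rm P.
Proof.
move=> sP HP t; split; first exact: sP.
apply: is_derive_eq (HP t) _.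
rewrite feedback_closed_loop /feedback_Q /feedback_S trmxB !trmx_mul trmxK symR.
rewrite !(mulmxDl, mulmxDr, mulmxN, mulNmx) !mulmxA mulmxK//.
rewrite -[_ *m invmx (Rm t) *m Rm t]mulmxA mulVmx// mulmx1.
by apply/matrixP => i j; rewrite !(mxDE, mxNE); ring.
Qed.

Lemma feedback_C_LQ : smooth K -> bounded_mx K -> smooth Rm -> bounded_mx Rm ->
  unif_posdef Rm -> C_LQ feedback_Q feedback_S Rm.
Proof.
move=> sK bK sR bR uR'.
have sKT := smooth_trmx sK; have bKT := bounded_mxT bK.
split.
- split.
  + by move=> t; rewrite /sym /feedback_Q !trmx_mul trmxK symR mulmxA.
  + exact: (smooth_mulmx (smooth_mulmx sKT sR) sK).
  + exact: bounded_mxM (bounded_mxM bKT bR) bK.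
- split; first exact: smooth_mulmx sKT sR.
  exact: bounded_mxM bKT bR.
- by split; [exact: symR|exact: sR|exact: bR].
- exact: uR'.
- move=> t x; rewrite /feedback_Q /feedback_S trmx_mul trmxK symR.
  rewrite mulmxK// !mulmxA subrr qform_mx0; exact: lexx.
Qed.

End Feedback.

(** * Syntheses of general costs *)

Section Synthesis.
Variables (R : realType) (n m : nat).
Variables (A : R -> 'M[R]_n) (B : R -> 'M[R]_(n, m)).
Variables (PhiA : R -> R -> 'M[R]_n).
Hypotheses (hPhiA : is_transition A PhiA).
Hypotheses (sA : smooth A) (bA : bounded_mx A) (sB : smooth B) (bB : bounded_mx B).
Hypothesis (hgram : gramian_condition PhiA B).
Variables (Q : R -> 'M[R]_n) (S : R -> 'M[R]_(n, m)) (Rm : R -> 'M[R]_m).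
Hypothesis (hC : C_LQ Q S Rm).

Let sQ : smooth Q. Proof. by case: hC => -[]. Qed.
Let sS : smooth S. Proof. by case: hC => _ []. Qed.
Let sR : smooth Rm. Proof. by case: hC => _ _ []. Qed.
Let bQ : bounded_mx Q. Proof. by case: hC => -[]. Qed.
Let bS : bounded_mx S. Proof. by case: hC => _ []. Qed.
Let bR : bounded_mx Rm. Proof. by case: hC => _ _ []. Qed.
Let symR t : sym (Rm t). Proof. by case: hC => _ _ [/(_ t)]. Qed.
Let pR : forall t, posdef (Rm t).
Proof. by case: hC => _ _ _ u _; exact: unif_posdef_posdef. Qed.

Lemma riccati_solution_bounded P : riccati_solution A B Q S Rm P -> bounded_mx P.
Proof.
move=> HP; have [s [beta [s0 beta0 H]]] := hgram.
exact: (riccati_bounded sA sB symR pR bA bB bQ bS bR hPhiA s0 beta0 H HP).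
Qed.

Lemma riccati_stabilizing_unique P1 P2 :
  riccati_solution A B Q S Rm P1 -> riccati_solution A B Q S Rm P2 ->
  exp_stable (closed_loop A B S Rm P1) ->
  exp_stable (closed_loop A B S Rm P2) -> P1 = P2.
Proof.
move=> H1 H2 S1 S2; apply/funext => t; apply/eqP; rewrite -subr_eq0; apply/eqP.
apply: (sylvester_stable0 (D := fun t => P1 t - P2 t) S1 S2).
  exact: bounded_mxB (riccati_solution_bounded H1) (riccati_solution_bounded H2).
exact: riccati_diff.
Qed.

Variables (Pp Pm : R -> 'M[R]_n).
Hypotheses (HPp : riccati_solution A B Q S Rm Pp).
Hypotheses (HPm : riccati_solution A B Q S Rm Pm).
Hypothesis stable_p : exp_stable (closed_loop A B S Rm Pp).
Hypothesis antistable_m : exp_antistable (closed_loop A B S Rm Pm).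

Lemma synthesis_coupled : exists V : R -> 'M[R]_n, V 0 \in unitmx /\
  coupled B (closed_loop A B S Rm Pp) (closed_loop A B S Rm Pm) V
    (fun t => invmx (Rm t)).
Proof.
have sP := closed_loop_smooth sA sB sQ sS sR pR.
pose D t := Pm t - Pp t.
have HD := riccati_diff symR HPm HPp.
have HN t : closed_loop A B S Rm Pm t - closed_loop A B S Rm Pp t =
    - (B t *m invmx (Rm t) *m (B t)^T) *m D t.
  by rewrite closed_loop_diff -[Pp t - Pm t]opprB mulmxN mulNmx.
have uD := sylvester_unit (smooth_continuous (sP _ HPp))
  (smooth_continuous (sP _ HPm)) stable_p antistable_m HD HN.
(* The sign compensates [A_- - A_+ = - B R^-1 B^T D]. *)
exists (fun t => - invmx (D t)); split.
  by rewrite -scaleN1r unitmxZ ?unitrN1// unitmx_inv; exact: uD.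
move=> t; split.
- have [s1 _] := HPm t; have [s2 _] := HPp t.
  by rewrite /sym trmxN trmx_inv trmxB s1 s2.
- apply: is_derive_eq (is_deriveN (is_derive_invmx uD (HD t))) _.
  rewrite opprK -/(D t) mulmxBr mulmxBl !mulmxN !mulNmx !mulmxA mulVmx ?mul1mx//.
    by rewrite -[_ *m D t *m invmx _]mulmxA mulmxV ?mulmx1//; exact: uD.
  exact: uD.
- by rewrite HN mulmxN !mulNmx opprK -mulmxA mulmxV ?mulmx1//; exact: uD.
Qed.

(** The optimal feedback of [P_+], bounded because the Gramian condition bounds [P_+]. *)
Lemma synthesis_feedback : exists K : R -> 'M[R]_(m, n),
  [/\ smooth K, bounded_mx K &
    forall t, closed_loop A B S Rm Pp t = A t - B t *m K t].
Proof.
have sI : smooth (fun t => invmx (Rm t)).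
  by apply: (smooth_invmx _ sR) => t; exact: posdef_unit.
have sP := riccati_smooth sA sB sQ sS sR pR HPp.
have bP := riccati_solution_bounded HPp.
have bI : bounded_mx (fun t => invmx (Rm t)).
  by case: hC => _ _ _ u _; exact: unif_posdef_invmx_bounded.
exists (fun t => invmx (Rm t) *m ((S t)^T + (B t)^T *m Pp t)); split.
- exact: (smooth_mulmx sI (smoothD (smooth_trmx sS) (smooth_mulmx (smooth_trmx sB) sP))).
- apply: bounded_mxM bI (bounded_mxD (bounded_mxT bS) _).
  exact: bounded_mxM (bounded_mxT bB) bP.
- by move=> t; rewrite /closed_loop mulmxA.
Qed.

End Synthesis.

(** [(B^T B)^-1 B^T] is a left inverse of [B], so [A - B K] determines [K]. *)
Lemma gram_projection (R : realType) n m p (B : R -> 'M[R]_(n, m))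
    (L : 'M[R]_(m, p)) t : injective_input B ->
  invmx ((B t)^T *m B t) *m (B t)^T *m (B t *m L) = L.
Proof.
move=> hinj; rewrite -!mulmxA (mulmxA (B t)^T) mulKmx//.
exact: injective_gram_unit.
Qed.

Lemma comparison_bounds (R : realType) m (R0 R1 : R -> 'M[R]_m) (mu nu : R) :
  (forall t, sym (R1 t)) -> bounded_mx R0 -> unif_posdef R0 ->
  0 <= mu -> (forall t x, qform (R0 t) x <= mu * qform (R1 t) x) ->
  0 <= nu -> (forall t x, qform (R1 t) x <= nu * qform (R0 t) x) ->
  bounded_mx R1 /\ unif_posdef R1.
Proof.
move=> sR1 [c Hc] [a [a0 Ha]] mu0 Hmu nu0 Hnu.
(* Nonnegativity of [R1] follows from [0 < R0 <= mu R1]. *)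
have q1 t x : 0 <= qform (R1 t) x.
  have := le_trans (posdef_shift x (Ha t)) (Hmu t x).
  have d0 := dot_ge0 x; move=> H; rewrite leNgt; apply/negP => q0.
  have : 0 < dot x x.
    rewrite lt_neqAle d0 andbT; apply: contraTneq q0 => /esym/dot_eq0 ->.
    by rewrite qform0 ltxx.
  by move=> dx; nra.
split.
- exists (3 * (nu * (`|c| * (2 * m%:R)))) => t.
  apply: norm_sym_le => //; last by rewrite !mulr_ge0.
  move=> x; rewrite ger0_norm// (le_trans (Hnu t x))// -mulrA ler_wpM2l//.
  rewrite (le_trans (ler_norm _))// (le_trans (qform_le _ _))//.
  rewrite ler_wpM2r ?dot_ge0// ler_wpM2r ?mulr_ge0//.
  exact: le_trans (Hc t) (ler_norm _).
(* [2 (mu + 1)] in place of [mu] keeps the denominator positive and the inequality strict. *)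
- exists (a / (2 * (mu + 1))); split; first by rewrite divr_gt0// mulr_gt0//; lra.
  move=> t x x0; rewrite qformD qformN qform_scalar subr_gt0.
  have mu1 : 0 < 2 * (mu + 1) by lra.
  rewrite mulrAC ltr_pdivrMr//.
  have := le_trans (posdef_shift x (Ha t)) (Hmu t x).
  have := dot_gt0 x0; have := q1 t x => q d H.
  nra.
Qed.

Lemma invmx_sandwich (F : comUnitRingType) p (W X Y : 'M[F]_p) : W \in unitmx ->
  invmx W *m (X *m W + W *m Y) *m invmx W = invmx W *m X + Y *m invmx W.
Proof. by move=> uW; rewrite mulmxDr mulmxDl mulKmx// mulmxA mulmxK. Qed.

(** A zero factor would make the determinant vanish in positive size; in size 0 the determinant is
    1, and so are its powers. *)
Lemma powR_det_neq0 (R : realType) m (M N : 'M[R]_m) (x : R) :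
  \det ((\det M `^ x) *: N) = 1 -> \det M `^ x != 0.
Proof.
case: m M N => [|m] M N; first by rewrite !det_mx00 powR1 oner_neq0.
by apply: contra_eqN => /eqP ->; rewrite scale0r det0// eq_sym oner_neq0.
Qed.

(* The integrand carries Phi_{A+}(t,s): with V' = A+ V + V A+^T + B Z B^T and
   (A- - A+) V = B Z B^T one has V' = A- V + V A+^T, and the integral equals
   V(t) (I - Phi_{A-}(t,0)^{-T} Phi_{A+}(t,0)^T). *)
Theorem proposition3p10 (R : realType) (n m : nat)
    (A : R -> 'M[R]_n) (B : R -> 'M[R]_(n, m))
    (PhiA : R -> R -> 'M[R]_n) (hPhiA : is_transition A PhiA)
    (hAB : [/\ smooth A, bounded_mx A, smooth B & bounded_mx B])
    (hinj : injective_input B)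
    (hspan : span_condition A B)
    (hgram : gramian_condition PhiA B)
    (Ap Am : R -> 'M[R]_n)
    (hsynth : exists c : cost R n m, synthesis_described_by A B c Ap Am)
    (PhiAp PhiAm : R -> R -> 'M[R]_n)
    (hPhiAp : is_transition Ap PhiAp) (hPhiAm : is_transition Am PhiAm)
    (c : cost R n m) :
  (canonical_cost A B c /\ synthesis_described_by A B c Ap Am) <->
  exists (K : R -> 'M[R]_(m, n)) (Rm : R -> 'M[R]_m),
    [/\ forall t x u, c t x u = feedback_cost K Rm t x u,
        \det (Rm 0) = 1,
        forall t, K t = invmx ((B t)^T *m B t) *m (B t)^T *m (A t - Ap t) &
        exists Z : R -> 'M[R]_m,
          [/\ smooth Z,
              forall t, sym (Z t) /\ posdef (Z t),
              forall t,
                (Am t - Ap t) *m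
                  mxint 0 t (fun s => PhiAp t s *m B s *m Z s *m (B s)^T
                                        *m (PhiAp t s)^T)
                - B t *m Z t *m (B t)^T
                  *m (1%:M - (invmx (PhiAm t 0))^T *m (PhiAp t 0)^T) = 0 &
              forall t, Rm t = (\det (Z 0) `^ (n%:R)^-1) *: invmx (Z t)]].
Proof.
case: hAB => sA bA sB bB; split.
- case=> -[K [R1 [cE [symR sR bR] [uR detR] [sK bK] stK]]].
  case=> Q [S [Rm [Pp [Pm [[hC cQ] [HPp stp] [HPm stm] ApmE]]]]].
  have pR := unif_posdef_posdef uR.
  (* The description of the synthesis comes with its own matrices, which the cost determines. *)
  have cQS t : [/\ Q t = feedback_Q K R1 t, S t = feedback_S K R1 t & Rm t = R1 t].
    apply: feedback_quadratic_inj => //.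
    + by case: hC => -[/(_ t)].
    + by case: hC => _ _ [/(_ t)].
    + by move=> x u; rewrite -cE cQ.
  have EQ : Q = feedback_Q K R1 by apply/funext => t; have [] := cQS t.
  have ES : S = feedback_S K R1 by apply/funext => t; have [] := cQS t.
  have ER : Rm = R1 by apply/funext => t; have [] := cQS t.
  subst Q S Rm.
  have cl0 t : closed_loop A B (feedback_S K R1) R1 (fun=> 0) t = A t - B t *m K t.
    by rewrite feedback_closed_loop// mulmx0 subr0.
  (* [P = 0] is a solution with stable closed loop [A - B K], so uniqueness yields [P_+ = 0]. *)
  have HP0 : riccati_solution A B (feedback_Q K R1) (feedback_S K R1) R1 (fun=> 0).
    apply: feedback_riccati => // [t|t]; first by rewrite /sym trmx0.
    by rewrite mul0mx mulmx0 !oppr0 addr0; exact: is_derive_cst.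
  have st0 : exp_stable (closed_loop A B (feedback_S K R1) R1 (fun=> 0)).
    by have -> : closed_loop A B (feedback_S K R1) R1 (fun=> 0) =
      (fun t => A t - B t *m K t) by apply/funext.
  have EP := riccati_stabilizing_unique hPhiA sA bA sB bB hgram hC HPp HP0 stp st0.
  have EAp : Ap = closed_loop A B (feedback_S K R1) R1 Pp.
    by apply/funext => t; have [] := ApmE t.
  have EAm : Am = closed_loop A B (feedback_S K R1) R1 Pm.
    by apply/funext => t; have [] := ApmE t.
  have ApK t : Ap t = A t - B t *m K t by rewrite EAp EP cl0.
  have [V [uV HV]] := synthesis_coupled sA sB hC HPp HPm stp stm.
  rewrite -EAp -EAm in HV.
  have uR1 t : R1 t \in unitmx by exact: posdef_unit.
  have [[_ sQ _] [sS _] _ _ _] := hC.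
  have scl := closed_loop_smooth sA sB sQ sS sR pR.
  have sAp : smooth Ap by rewrite EAp; exact: scl HPp.
  have sAm : smooth Am by rewrite EAm; exact: scl HPm.
  have sZ := smooth_invmx uR1 sR.
  exists K, R1; split=> // [t|].
    by rewrite ApK opprB addrC subrK gram_projection.
  (* With this [Z], [det Z(0) = 1] and the normalizing factor is 1. *)
  exists (fun t => invmx (R1 t)); split.
  + exact: sZ.
  + by move=> t; split; [exact: sym_invmx|exact: posdef_invmx].
  + exact: (coupled_equation sB sAp sAm hPhiAp hPhiAm sZ HV).
  + by move=> t; rewrite det_inv detR invr1 powR1 scale1r invmxK.
- case=> K [Rm [cE detR KE [Z [sZ pZ hZ RmE]]]].
  have [c0 [Q0 [S0 [R0 [Pp [Pm [[hC _] [HPp stp] [HPm stm] ApmE]]]]]]] := hsynth.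
  have EAp : Ap = closed_loop A B S0 R0 Pp.
    by apply/funext => t; have [] := ApmE t.
  have EAm : Am = closed_loop A B S0 R0 Pm.
    by apply/funext => t; have [] := ApmE t.
  have [K0 [sK bK ApK0]] :=
    synthesis_feedback hPhiA sA bA sB bB hgram hC HPp.
  rewrite -EAp in ApK0 stp; rewrite -EAm in stm.
  (* Hence [K] inherits smoothness and boundedness from the feedback of the given synthesis. *)
  have EK : K0 = K.
    by apply/funext => t; rewrite KE ApK0 opprB addrC subrK gram_projection.
  subst K0; rename ApK0 into ApK.
  have [V [uV HV]] : exists V, V 0 \in unitmx /\ coupled B Ap Am V (fun t => invmx (R0 t)).
    have := synthesis_coupled sA sB hC HPp HPm; rewrite -EAp -EAm; exact.
  have [[_ sQ _] [sS _] [symR0 sR0 bR0] uR0 _] := hC.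
  have pR0 := unif_posdef_posdef uR0.
  have scl := closed_loop_smooth sA sB sQ sS sR0 pR0.
  have sAp : smooth Ap by rewrite EAp; exact: scl HPp.
  have sAm : smooth Am by rewrite EAm; exact: scl HPm.
  have sZ0 : smooth (fun t => invmx (R0 t)).
    by apply: (smooth_invmx _ sR0) => t; exact: posdef_unit.
  have pZ0 t : sym (invmx (R0 t)) /\ posdef (invmx (R0 t)).
    by split; [exact: sym_invmx|exact: posdef_invmx].
  have [C [uC symC HW]] := converse_coupled sA sB sK sAp sAm hPhiAp hPhiAm
    hspan hinj ApK HV uV sZ0 sZ pZ0 pZ hZ.
  set W := (fun t => _) in HW.
  have W0 : W 0 = C.
    by rewrite /W (transition_id hPhiAp) (transition_id hPhiAm) trmx1 mulmx1 mul1mx.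
  have uW t : W t \in unitmx.
    rewrite /W !unitmx_mul unitmx_tr uC.
    have [cAp cAm] := (smooth_continuous sAp, smooth_continuous sAm).
    by rewrite (transition_unit cAp hPhiAp) (transition_unit cAm hPhiAm).
  have uZ t : Z t \in unitmx by apply: posdef_unit; have [] := pZ t.
  set k := _ `^ _ in RmE.
  have k0 : 0 < k.
    rewrite lt_neqAle powR_ge0 andbT eq_sym.
    by move: detR; rewrite RmE => /powR_det_neq0.
  have eRm : Rm = (fun t => k *: invmx (Z t)) by apply/funext.
  have symR t : sym (Rm t).
    by rewrite RmE /sym linearZ/= trmx_inv; have [->] := pZ t.
  have sR : smooth Rm by rewrite eRm; exact: smooth_scale (smooth_invmx uZ sZ).
  have uWV0 : W 0 \in unitmx := uW 0.
  (* Comparison in both directions: [R_0 <= mu Z^-1] and [Z^-1 <= nu R_0]. As [Rm = k Z^-1], the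
     constants for [Rm] are [mu / k] and [k nu]. *)
  have [mu [mu0 Hmu]] := coupled_comparison sAp sAm hPhiAp hPhiAm hinj HV HW uV pZ0 pZ.
  have [nu [nu0 Hnu]] := coupled_comparison sAp sAm hPhiAp hPhiAm hinj HW HV uWV0 pZ pZ0.
  have [||||bR uR] := @comparison_bounds R m R0 Rm (mu / k) (k * nu) symR bR0 uR0 _ _ _ _.
  + by rewrite divr_ge0// ltW.
  + move=> t x; have := Hmu t x; rewrite invmxK RmE qformZ.
    by rewrite mulrA divfK// gt_eqF.
  + by rewrite mulr_ge0// ltW.
  + move=> t x; have := Hnu t x; rewrite invmxK RmE qformZ -mulrA.
    by rewrite ler_pM2l.
  have pR := unif_posdef_posdef uR.
  have ApE : (fun t => A t - B t *m K t) = Ap by apply/funext => t; rewrite ApK.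
  split; first by exists K, Rm; split=> //; rewrite ApE.
  (* With [P_+ = 0] and weight [Rm^-1 = k^-1 Z], the coupled solution is [k^-1 W], and [P_-] is
     minus its inverse. *)
  pose P t := (- k) *: invmx (W t).
  have iRm t : invmx (Rm t) = k^-1 *: Z t.
    by rewrite RmE invmxZ ?invmxK// -RmE posdef_unit.
  have clP t : closed_loop A B (feedback_S K Rm) Rm P t = Am t.
    rewrite feedback_closed_loop// -ApK iRm /P.
    have [_ _ EW] := HW t.
    rewrite -scalemxAr -scalemxAr -!scalemxAl scalerA mulNr mulfV ?gt_eqF//.
    rewrite -EW scaleN1r opprK -mulmxA mulmxV// mulmx1.
    by rewrite addrC subrK.
  exists (feedback_Q K Rm), (feedback_S K Rm), Rm, (fun=> 0), P; split.
  + split; first exact: feedback_C_LQ.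
    by move=> t x u; rewrite cE feedback_quadratic.
  + have cl0 : closed_loop A B (feedback_S K Rm) Rm (fun=> 0) = Ap.
      by apply/funext => t; rewrite feedback_closed_loop// mulmx0 subr0 ApK.
    split; last by rewrite cl0.
    apply: feedback_riccati => // [t|t]; first by rewrite /sym trmx0.
    by rewrite mul0mx mulmx0 !oppr0 addr0; exact: is_derive_cst.
  + split; last by have -> : closed_loop A B (feedback_S K Rm) Rm P = Am by apply/funext.
    apply: feedback_riccati => // t.
      by have [sW _ _] := HW t; rewrite /sym /P linearZ/= trmx_inv sW.
    rewrite clP -ApK; have [_ dW _] := HW t.
    have := is_derive_mulmxl (- k)%:M (is_derive_invmx uW dW).
    under eq_fun do rewrite mul_scalar_mx.
    move=> H; apply: is_derive_eq H _.
    rewrite mul_scalar_mx invmx_sandwich//.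
    by rewrite /P -scalemxAl -scalemxAr !scaleNr !scalerN opprK scalerDr !opprK.
  + move=> t; rewrite clP feedback_closed_loop// mulmx0 subr0.
    by rewrite ApK.
Qed.
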